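(* Let $(M,\Omega)$ be a symplectic manifold and let $\nabla$ be a symplectic connection on $(M,\Omega)$ having nonpositive symplectic sectional curvature. Let $\gamma:I\to M$ be a maximal geodesic of $\nabla$, where $I\subset\mathbb{R}$ is an open interval, and let $J(t)$ be a Jacobi field along $\gamma(I)$. Then one of the following mutually exclusive possibilities occurs: (1) $\Omega(J,\dot\gamma)$ has at most one zero in $I$. In particular $J$ has at most one zero on $\gamma(I)$. (2) $\Omega(J,\dot\gamma)$ is identically zero on $I$. In particular, if $p,q\in M$ are conjugate with respect to $\gamma$, then any Jacobi field along $\gamma(I)$ vanishing at $p$ and $q$ is coisotropic.
   Context: $M$ is smooth and connected. An affine connection $\nabla$ on $(M,\Omega)$ is symplectic if it is torsion-free and $\nabla\Omega=0$. Its curvature is $R(X,Y)Z=\nabla_X\nabla_YZ-\nabla_Y\nabla_XZ-\nabla_{[X,Y]}Z$. A two-dimensional subspace $L\subset T_pM$ is symplectic if $\Omega|_L$ is nondegenerate; for such $L$, $\mathscr{K}_{p,L}(Z)=\Omega(R(X,Y)Z,Z)/\Omega(X,Y)$ for any basis $X,Y$ of $L$ (independent of the choice). $\nabla$ has nonpositive symplectic sectional curvature if $\mathscr{K}_{p,L}(Z)\le 0$ for every $p\in M$, every two-dimensional symplectic $L\subset T_pM$, and every $Z\in L$. A Jacobi field along a geodesic $\gamma$ is a vector field $J(t)$ along $\gamma$ satisfying $\ddot J=R(\dot\gamma,J)\dot\gamma$, where $\dot J=\nabla_{\dot\gamma}J$ and $\ddot J=\nabla_{\dot\gamma}\dot J$.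 It is coisotropic if $\Omega(J(t),\dot\gamma(t))=0$ for all $t\in I$. Zeros of $J$ are counted with respect to the parameter $t\in I$. Points $p=\gamma(a)$, $q=\gamma(b)$ with $a\ne b$ are conjugate with respect to $\gamma$ if there is a not identically zero Jacobi field along $\gamma$ vanishing at $t=a$ and $t=b$. *)

(* Defs.v *)
(* Symplectic connections, geodesics and Jacobi fields on smooth manifolds,
   over MathComp-Analysis. *)
From HB Require Import structures.
From mathcomp Require Import all_boot all_order all_algebra.
From mathcomp Require Import all_classical all_reals all_analysis.
Set Implicit Arguments.
Unset Strict Implicit.
Unset Printing Implicit Defensive.
Import Order.TTheory GRing.Theory Num.Theory.
Import numFieldNormedType.Exports.
Local Open Scope classical_set_scope.
Local Open Scope ring_scope.

(* C^oo on the open set A: all iterated directional derivatives exist and are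
   differentiable (hence continuous) at every point of A. *)
Definition smooth_on (R : realType) (V W : normedModType R) (A : set V)
    (f : V -> W) : Prop :=
  forall (vs : seq V) (x : V), A x ->
    differentiable (foldr (fun v (g : V -> W) => fun y => 'D_v g y) f vs) x.

(* The atlas need not be maximal. [chart_inv c] is only meaningful on the image
   of the chart [c]. *)
Record manifold (R : realType) (n : nat) := Manifold {
  carrier :> topologicalType;
  chart : Type;
  dom : chart -> set carrier;
  phi : chart -> carrier -> 'rV[R]_n;
  chart_inv : chart -> 'rV[R]_n -> carrier;
  chart_at : carrier -> chart;
  mem_chart_at : forall p, dom (chart_at p) p;
  dom_open : forall c, open (dom c);
  phi_open : forall c, open (phi c @` dom c);
  phiK : forall c p, dom c p -> chart_inv c (phi c p) = p;
  phi_continuous : forall c p, dom c p -> {for p, continuous (phi c)};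
  chart_inv_continuous : forall c x, (phi c @` dom c) x ->
    {for x, continuous (chart_inv c)};
  transition_smooth : forall c d,
    smooth_on (phi c @` (dom c `&` dom d)) (fun x => phi d (chart_inv c x));
  carrier_hausdorff : hausdorff_space carrier;
  carrier_second_countable : @second_countable carrier;
  carrier_connected : connected [set: carrier]
}.

Arguments dom {R n m} c.
Arguments phi {R n m} c p.
Arguments chart_inv {R n m} c x.
Arguments chart_at {R n m} p.

(* A tangent vector is encoded as the family of its coordinate vectors in all
   charts; [tangent p] singles out the families representing elements of T_pM.
   The components in charts not containing p are set to 0, so that equality in
   [tvec M] is equality of tangent vectors. *)
Definition tvec (R : realType) (n : nat) (M : manifold R n) : Type :=
  chart M -> 'rV[R]_n.

Definition tangent (R : realType) (n : nat) (M : manifold R n) (p : M)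
    (v : tvec M) : Prop :=
  (forall c, ~ dom c p -> v c = 0) /\
  (forall c d, dom c p -> dom d p ->
     v d = 'D_(v c) (fun x => phi d (chart_inv c x)) (phi c p)).

Definition smooth_fun (R : realType) (n : nat) (M : manifold R n) (U : set M)
    (f : M -> R) : Prop :=
  forall c : chart M,
    smooth_on (phi c @` (U `&` dom c)) (fun x => f (chart_inv c x)).

Definition smooth_field (R : realType) (n : nat) (M : manifold R n) (U : set M)
    (X : M -> tvec M) : Prop :=
  (forall p, U p -> tangent p (X p)) /\
  (forall c : chart M,
     smooth_on (phi c @` (U `&` dom c)) (fun x => X (chart_inv c x) c)).

(* The derivative v(f) of a function f along v in T_pM. *)
Definition dirder (R : realType) (n : nat) (M : manifold R n) (p : M)
    (v : tvec M) (f : M -> R) : R :=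
  let c := chart_at p in
  'D_(v c) (fun x => f (chart_inv c x)) (phi c p).

(* The Lie bracket: in each chart, [X, Y]^k = X^i d_i Y^k - Y^i d_i X^k. *)
Definition bracket (R : realType) (n : nat) (M : manifold R n)
    (X Y : M -> tvec M) (p : M) : tvec M :=
  fun c => if `[< dom c p >]
           then 'D_(X p c) (fun x => Y (chart_inv c x) c) (phi c p)
                - 'D_(Y p c) (fun x => X (chart_inv c x) c) (phi c p)
           else 0.

(* The i-th coordinate vector field of the chart c, on the domain of c. *)
Definition coord_field (R : realType) (n : nat) (M : manifold R n)
    (c : chart M) (i : 'I_n) (q : M) : tvec M :=
  fun d => if `[< dom d q >]
           then 'D_('e_i) (fun x => phi d (chart_inv c x)) (phi c q)
           else 0.

Record symplectic_form (R : realType) (n : nat) (M : manifold R n)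
    (Omega : M -> tvec M -> tvec M -> R) : Prop := SymplecticForm {
  form_linear : forall p a u v w, tangent p u -> tangent p v -> tangent p w ->
    Omega p (a *: u + v) w = a * Omega p u w + Omega p v w;
  form_skew : forall p u v, tangent p u -> tangent p v ->
    Omega p u v = - Omega p v u;
  form_nondegenerate : forall p u, tangent p u ->
    (forall v, tangent p v -> Omega p u v = 0) -> u = 0;
  form_smooth : forall U X Y, open U -> smooth_field U X -> smooth_field U Y ->
    smooth_fun U (fun p => Omega p (X p) (Y p));
  form_closed : forall U X Y Z, open U ->
    smooth_field U X -> smooth_field U Y -> smooth_field U Z ->
    forall p, U p ->
      dirder p (X p) (fun q => Omega q (Y q) (Z q))
      + dirder p (Y p) (fun q => Omega q (Z q) (X q))
      + dirder p (Z p) (fun q => Omega q (X q) (Y q))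
      - Omega p (bracket X Y p) (Z p)
      - Omega p (bracket Y Z p) (X p)
      - Omega p (bracket Z X p) (Y p) = 0
}.

(* [nabla p v Y] is the covariant derivative of Y along v in T_pM, where Y is a
   vector field defined and smooth in a neighbourhood of p. *)
Record affine_connection (R : realType) (n : nat) (M : manifold R n)
    (nabla : M -> tvec M -> (M -> tvec M) -> tvec M) : Prop :=
  AffineConnection {
  conn_tangent : forall U Y, open U -> smooth_field U Y ->
    forall p v, U p -> tangent p v -> tangent p (nabla p v Y);
  conn_local : forall U Y Y', open U -> smooth_field U Y -> smooth_field U Y' ->
    (forall q, U q -> Y q = Y' q) ->
    forall p v, U p -> tangent p v -> nabla p v Y = nabla p v Y';
  conn_linear : forall U Y, open U -> smooth_field U Y ->
    forall p a v w, U p -> tangent p v -> tangent p w ->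
      nabla p (a *: v + w) Y = a *: nabla p v Y + nabla p w Y;
  conn_additive : forall U Y Y', open U -> smooth_field U Y ->
    smooth_field U Y' -> forall p v, U p -> tangent p v ->
      nabla p v (fun q => Y q + Y' q) = nabla p v Y + nabla p v Y';
  conn_leibniz : forall U f Y, open U -> smooth_fun U f -> smooth_field U Y ->
    forall p v, U p -> tangent p v ->
      nabla p v (fun q => f q *: Y q) = dirder p v f *: Y p + f p *: nabla p v Y;
  conn_smooth : forall U X Y, open U -> smooth_field U X -> smooth_field U Y ->
    smooth_field U (fun q => nabla q (X q) Y)
}.

Definition torsion_free (R : realType) (n : nat) (M : manifold R n)
    (nabla : M -> tvec M -> (M -> tvec M) -> tvec M) : Prop :=
  forall U X Y, open U -> smooth_field U X -> smooth_field U Y ->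
  forall p, U p -> nabla p (X p) Y - nabla p (Y p) X = bracket X Y p.

Definition parallel_form (R : realType) (n : nat) (M : manifold R n)
    (Omega : M -> tvec M -> tvec M -> R)
    (nabla : M -> tvec M -> (M -> tvec M) -> tvec M) : Prop :=
  forall U X Y Z, open U ->
  smooth_field U X -> smooth_field U Y -> smooth_field U Z ->
  forall p, U p ->
    dirder p (X p) (fun q => Omega q (Y q) (Z q)) =
    Omega p (nabla p (X p) Y) (Z p) + Omega p (Y p) (nabla p (X p) Z).

Definition symplectic_connection (R : realType) (n : nat) (M : manifold R n)
    (Omega : M -> tvec M -> tvec M -> R)
    (nabla : M -> tvec M -> (M -> tvec M) -> tvec M) : Prop :=
  [/\ affine_connection nabla, torsion_free nabla & parallel_form Omega nabla].

Definition curv (R : realType) (n : nat) (M : manifold R n)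
    (nabla : M -> tvec M -> (M -> tvec M) -> tvec M)
    (X Y Z : M -> tvec M) (p : M) : tvec M :=
  nabla p (X p) (fun q => nabla q (Y q) Z)
  - nabla p (Y p) (fun q => nabla q (X q) Z)
  - nabla p (bracket X Y p) Z.

(* w = R_p(x, y) z. The curvature is tensorial, so R(X, Y) Z takes the same
   value at p for all local vector fields X, Y, Z extending x, y, z (which
   exist for all tangent vectors x, y, z at p); w is this common value. *)
Definition curvature_at (R : realType) (n : nat) (M : manifold R n)
    (nabla : M -> tvec M -> (M -> tvec M) -> tvec M)
    (p : M) (x y z w : tvec M) : Prop :=
  forall U X Y Z, open U -> U p ->
    smooth_field U X -> smooth_field U Y -> smooth_field U Z ->
    X p = x -> Y p = y -> Z p = z -> curv nabla X Y Z p = w.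

(* L is a two-dimensional subspace of T_pM with basis x, y. *)
Definition plane_basis (R : realType) (n : nat) (M : manifold R n) (p : M)
    (L : set (tvec M)) (x y : tvec M) : Prop :=
  [/\ tangent p x, tangent p y,
      forall a b : R, a *: x + b *: y = 0 -> a = 0 /\ b = 0 &
      forall z, L z <-> exists a b : R, z = a *: x + b *: y].

Definition symplectic_plane (R : realType) (n : nat) (M : manifold R n)
    (Omega : M -> tvec M -> tvec M -> R) (p : M) (L : set (tvec M)) : Prop :=
  (exists x y, plane_basis p L x y) /\
  (forall x, L x -> (forall y, L y -> Omega p x y = 0) -> x = 0).

(* K_{p,L}(Z_p) for L spanned by X_p, Y_p. *)
Definition sectional_curvature (R : realType) (n : nat) (M : manifold R n)
    (Omega : M -> tvec M -> tvec M -> R)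
    (nabla : M -> tvec M -> (M -> tvec M) -> tvec M)
    (X Y Z : M -> tvec M) (p : M) : R :=
  Omega p (curv nabla X Y Z p) (Z p) / Omega p (X p) (Y p).

(* X, Y, Z range over all local extensions of a basis of L and of an element of
   L; the value of K depends on p, L and Z_p only. *)
Definition nonpositive_sectional_curvature (R : realType) (n : nat)
    (M : manifold R n) (Omega : M -> tvec M -> tvec M -> R)
    (nabla : M -> tvec M -> (M -> tvec M) -> tvec M) : Prop :=
  forall (p : M) (L : set (tvec M)), symplectic_plane Omega p L ->
  forall U X Y Z, open U -> U p ->
    smooth_field U X -> smooth_field U Y -> smooth_field U Z ->
    plane_basis p L (X p) (Y p) -> L (Z p) ->
    sectional_curvature Omega nabla X Y Z p <= 0.

Definition open_interval (R : realType) (I : set R) : Prop :=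
  [/\ open I, is_interval I & I !=set0].

Definition smooth_curve (R : realType) (n : nat) (M : manifold R n) (I : set R)
    (gamma : R -> M) : Prop :=
  (forall t, I t -> {for t, continuous gamma}) /\
  (forall c : chart M,
     smooth_on (I `&` gamma @^-1` dom c) (fun t => phi c (gamma t))).

Definition velocity (R : realType) (n : nat) (M : manifold R n)
    (gamma : R -> M) (t : R) : tvec M :=
  fun c => if `[< dom c (gamma t) >]
           then derive1 (fun s => phi c (gamma s)) t
           else 0.

(* A smooth vector field J along the restriction of gamma to I. *)
Definition field_along (R : realType) (n : nat) (M : manifold R n) (I : set R)
    (gamma : R -> M) (J : R -> tvec M) : Prop :=
  (forall t, I t -> tangent (gamma t) (J t)) /\
  (forall c : chart M,
     smooth_on (I `&` gamma @^-1` dom c) (fun t => J t c)).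

(* DJ is the covariant derivative of J along gamma: if J = sum_i J^i d_i in a
   chart c, then DJ = sum_i ((J^i)' d_i + J^i nabla_{gamma'} d_i). The right-hand
   side does not depend on c. *)
Definition covariant_derivative (R : realType) (n : nat) (M : manifold R n)
    (nabla : M -> tvec M -> (M -> tvec M) -> tvec M) (I : set R)
    (gamma : R -> M) (J DJ : R -> tvec M) : Prop :=
  forall t, I t -> forall c : chart M, dom c (gamma t) ->
    DJ t = \sum_(i < n)
      (derive1 (fun s => J s c 0 i) t *: coord_field c i (gamma t)
       + J t c 0 i *: nabla (gamma t) (velocity gamma t) (coord_field c i)).

Definition geodesic (R : realType) (n : nat) (M : manifold R n)
    (nabla : M -> tvec M -> (M -> tvec M) -> tvec M) (I : set R)
    (gamma : R -> M) : Prop :=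
  smooth_curve I gamma /\
  covariant_derivative nabla I gamma (velocity gamma) (fun=> 0).

(* gamma : I -> M is a geodesic which does not extend to a larger interval;
   the values of gamma outside I are irrelevant. *)
Definition maximal_geodesic (R : realType) (n : nat) (M : manifold R n)
    (nabla : M -> tvec M -> (M -> tvec M) -> tvec M) (I : set R)
    (gamma : R -> M) : Prop :=
  geodesic nabla I gamma /\
  (forall (I' : set R) (gamma' : R -> M), open_interval I' -> I `<=` I' ->
     geodesic nabla I' gamma' -> (forall t, I t -> gamma' t = gamma t) ->
     I' = I).

Definition jacobi_field (R : realType) (n : nat) (M : manifold R n)
    (nabla : M -> tvec M -> (M -> tvec M) -> tvec M) (I : set R)
    (gamma : R -> M) (J : R -> tvec M) : Prop :=
  field_along I gamma J /\
  exists DJ DDJ : R -> tvec M,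
    [/\ covariant_derivative nabla I gamma J DJ,
        covariant_derivative nabla I gamma DJ DDJ &
        forall t, I t ->
          curvature_at nabla (gamma t)
            (velocity gamma t) (J t) (velocity gamma t) (DDJ t)].

Definition coisotropic (R : realType) (n : nat) (M : manifold R n)
    (Omega : M -> tvec M -> tvec M -> R) (I : set R)
    (gamma : R -> M) (J : R -> tvec M) : Prop :=
  forall t, I t -> Omega (gamma t) (J t) (velocity gamma t) = 0.

Definition conjugate_points (R : realType) (n : nat) (M : manifold R n)
    (nabla : M -> tvec M -> (M -> tvec M) -> tvec M) (I : set R)
    (gamma : R -> M) (p q : M) : Prop :=
  exists a b : R, [/\ I a /\ I b, a <> b, gamma a = p, gamma b = q &
    exists J, [/\ jacobi_field nabla I gamma J, J a = 0, J b = 0 &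
      exists t, I t /\ J t <> 0]].

Definition at_most_one_zero (R : realType) (V : zmodType) (I : set R)
    (f : R -> V) : Prop :=
  forall s t, I s -> I t -> f s = 0 -> f t = 0 -> s = t.

(* Main.v *)
Require Import Defs.
From mathcomp Require Import all_boot all_order all_algebra.
From mathcomp Require Import all_classical all_reals all_analysis.
From mathcomp Require Import ring lra.
Set Implicit Arguments.
Unset Strict Implicit.
Unset Printing Implicit Defensive.
Import Order.TTheory GRing.Theory Num.Theory.
Import numFieldNormedType.Exports.
Local Open Scope classical_set_scope.
Local Open Scope ring_scope.

(** Put f := Omega(J, gamma').  Since Omega and gamma' are parallel along
    gamma, the Jacobi equation gives f'' = Omega(R(gamma', J) gamma', gamma').
    For a tangent vector x let q(x) := Omega(R(gamma', x) gamma', gamma') and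
    l(x) := Omega(x, gamma').  When l(x) <> 0 the vectors gamma', x span a
    symplectic plane, whose sectional curvature at gamma' is - q(x) / l(x);
    the curvature hypothesis therefore says that q(x) l(x) >= 0 for all x.

    The first consequence is f f'' >= 0, so (f f')' >= 0.  If f vanishes at
    a < b, then f f' is nondecreasing and zero at both ends, hence zero on
    [a, b]; so f^2 is constant there and f = 0 on [a, b]
    ([zero_between_zeros]).

    The second consequence propagates this vanishing to all of I.  A linear
    form q with q l >= 0 is a multiple of l ([proportional_forms]), so that
    f'' = kappa f for a function kappa of t alone.  Near a point where
    gamma' <> 0, nondegeneracy provides a constant-coefficient field e with
    l(e) <> 0, and kappa = q(e) / l(e) is continuous; by Gronwall f vanishes
    near each point where f = f' = 0.  Near a point where gamma' = 0 the
    geodesic equation, read as a linear system for gamma', gives gamma' = 0 and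
    again f = 0.  The set {f = f' = 0} is thus open and closed in I
    ([zero_of_two_zeros]).

    All geometric computations use the fields with constant coefficients in a
    chart ([const_field]): they are defined on the whole chart domain, depend
    linearly on their coefficients, and commute.  Quantities such as
    Omega(J, gamma') are then multilinear expressions in the coefficients whose
    dependence on the base point is smooth, and [is_derive_linear_form] and
    [continuous_linear_form] reduce their regularity in t to that of each
    variable separately. *)

(** * Differentials and smooth maps *)

Section DifferentiableCalculus.
Context {R : realType} {V W U : normedModType R}.

Lemma near_eq_differentiable (f g : V -> W) x :
  {near x, f =1 g} -> differentiable f x -> differentiable g x.
Proof.
move=> fg df; have fgx : f x = g x by exact: (nbhs_singleton fg).
have -> : g = f + (g - f).
  by apply/funext => y; rewrite /= addrC !fctE subrK.
apply: differentiableD => //.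
set h := g - f; have hx : h x = 0 by rewrite /h !fctE fgx subrr.
have h0 : h \o shift x = cst (h x) + (\0 : V -> W) +o_ 0 id.
  apply/eqaddoP => _/posnumP[e]; rewrite near_simpl.
  move: fg; rewrite (near_shift 0) subr0 => fg; near=> y.
  have hy : h (y + x) = 0.
    rewrite /h !fctE; apply/eqP; rewrite subr_eq0 eq_sym; apply/eqP.
    by have := near fg y; apply.
  by rewrite /= !fctE /= hy hx addr0 subrr normr0 mulr_ge0.
apply/diff_locallyP; rewrite (diff_unique _ h0)//; first by split=> // y; exact: cvg_cst.
by move=> y; exact: cvg_cst.
Unshelve. all: by end_near. Qed.

Lemma derive_comp (f : V -> W) (g : W -> U) x v :
  differentiable f x -> differentiable g (f x) ->
  'D_v (fun y => g (f y)) x = 'D_('D_v f x) g (f x).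
Proof.
move=> df dg; rewrite !deriveE//; last exact: differentiable_comp.
by rewrite diff_comp.
Qed.

Lemma derive_dirP (f : V -> W) x a u v : differentiable f x ->
  'D_(a *: u + v) f x = a *: 'D_u f x + 'D_v f x.
Proof. by move=> df; rewrite !deriveE// linearP. Qed.

End DifferentiableCalculus.

(** A recursive form of differentiability to order k + 1: peeling off the
    innermost derivative first makes the closure properties below provable by
    induction on k. *)
Fixpoint ck {R : realType} {V W : normedModType R} k (A : set V) (f : V -> W)
    : Prop :=
  (forall x, A x -> differentiable f x) /\
  (if k is k'.+1 then forall v, ck k' A (fun x => 'D_v f x) else True).

Section Ck.
Context {R : realType} {V : normedModType R}.
Implicit Types (W : normedModType R) (A : set V).

Lemma smooth_onP W A (f : V -> W) : smooth_on A f <-> forall k, ck k A f.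
Proof.
split=> [sf k|cf vs].
  elim: k f sf => [|k IH] f sf /=; split=> //; try by move=> x; exact: (sf [::]).
  by move=> v; apply: IH => vs x Ax; have := sf (rcons vs v) x Ax; rewrite foldr_rcons.
elim/last_ind: vs f cf => [|vs v IH] f cf x Ax /=.
  by have [+ _] := cf 0%N; exact.
by rewrite foldr_rcons; apply: IH => // k; have [_] := cf k.+1; exact.
Qed.

Lemma ck_differentiable W k A (f : V -> W) : ck k A f ->
  forall x, A x -> differentiable f x.
Proof. by case: k => [|k] []. Qed.

Lemma ckS W k A (f : V -> W) : ck k.+1 A f -> ck k A f.
Proof.
elim: k f => [|k IH] f [df cf]; split=> // v.
exact: IH (cf v).
Qed.

Lemma ck_eq W k A (f g : V -> W) : open A -> (forall x, A x -> f x = g x) ->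
  ck k A f -> ck k A g.
Proof.
move=> oA; have eqn h1 h2 x : (forall x, A x -> h1 x = h2 x :> W) -> A x ->
    {near x, h1 =1 h2}.
  by move=> h12 Ax; apply: (filterS h12); exact: open_nbhs_nbhs.
elim: k f g => [|k IH] f g fg [df cf]; (split => [x Ax|]; first
  by apply: near_eq_differentiable (df x Ax); exact: eqn).
  by [].
move=> v; apply: IH (cf v) => x Ax; apply: near_eq_derive; exact: eqn.
Qed.

Lemma ck_cst W k A (w : W) : ck k A (fun=> w).
Proof.
elim: k w => [|k IH] w /=; split=> //; try by move=> x _; exact: differentiable_cst.
move=> v; rewrite (_ : derive _ ^~ v = fun=> 0)//.
by apply/funext => x; exact: derive_cst.
Qed.

Lemma ckD W k A (f g : V -> W) : open A -> ck k A f -> ck k A g ->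
  ck k A (fun x => f x + g x).
Proof.
move=> oA; elim: k f g => [|k IH] f g [df cf] [dg cg];
  (split => [x Ax|]; first by apply: differentiableD; [exact: df|exact: dg]).
  by [].
move=> v; apply: (ck_eq oA _ (IH _ _ (cf v) (cg v))) => x Ax.
by rewrite [RHS]deriveD//; apply: diff_derivable; [exact: df|exact: dg].
Qed.

Lemma ck_sum W k A n (f : 'I_n -> V -> W) : open A -> (forall i, ck k A (f i)) ->
  ck k A (fun x => \sum_(i < n) f i x).
Proof.
move=> oA; elim: n f => [|n IH] f cf.
  by apply: (ck_eq oA _ (@ck_cst _ k A 0)) => x _; rewrite big_ord0.
apply: (ck_eq oA _ (ckD oA (cf ord0) (IH (fun i => f (lift ord0 i)) _))) => //.
by move=> x _; rewrite big_ord_recl.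
Qed.

Lemma ckM k A (f g : V -> R) : open A -> ck k A f -> ck k A g ->
  ck k A (fun x => f x * g x).
Proof.
move=> oA; elim: k f g => [|k IH] f g cf cg.
  split=> // x Ax.
  by apply: differentiableM; [exact: (ck_differentiable cf)|exact: (ck_differentiable cg)].
split=> [x Ax|v].
  by apply: differentiableM; [exact: (ck_differentiable cf)|exact: (ck_differentiable cg)].
have [[df cf'] [dg cg']] := (cf, cg).
apply: (ck_eq oA _ (ckD oA (IH _ _ (ckS cf) (cg' v)) (IH _ _ (ckS cg) (cf' v)))).
move=> x Ax.
by rewrite [RHS]deriveM//; apply: diff_derivable; [exact: df|exact: dg].
Qed.

Lemma ckZl W k A (f : V -> R) (w : W) : open A -> ck k A f ->
  ck k A (fun x => f x *: w).
Proof.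
move=> oA; elim: k f => [|k IH] f [df cf]; (split=> [x Ax|];
  first exact/differentiableZl/df).
  by [].
move=> v; apply: (ck_eq oA _ (IH _ (cf v))) => x Ax.
rewrite [RHS]deriveE; last exact/differentiableZl/df.
by rewrite diffZl ?deriveE//; exact: df.
Qed.

Lemma ck_coord k A n (f : V -> 'rV[R]_n) i : open A -> ck k A f ->
  ck k A (fun x => f x 0 i).
Proof.
move=> oA; elim: k f => [|k IH] f [df cf]; (split=> [x Ax|];
  first exact: (differentiable_comp (df x Ax) (differentiable_coord (f x) 0 i))).
  by [].
move=> v; apply: (ck_eq oA _ (IH _ (cf v))) => x Ax.
by rewrite derive_mx ?mxE//; exact/diff_derivable/df.
Qed.

Lemma ck_row k A n (f : V -> 'rV[R]_n) : open A ->
  (forall i, ck k A (fun x => f x 0 i)) -> ck k A f.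
Proof.
move=> oA cf.
apply: (ck_eq oA _ (ck_sum oA (fun i => ckZl (delta_mx 0 i) oA (cf i)))) => x _.
by rewrite -row_sum_delta.
Qed.

End Ck.

Section CkComp.
Context {R : realType} {V : normedModType R} {m : nat}.
Variables (A : set V) (B : set 'rV[R]_m).
Hypotheses (oA : open A) (oB : open B).

Lemma derive_comp_coord (f : V -> 'rV[R]_m) (g : 'rV[R]_m -> R) x v :
  differentiable f x -> differentiable g (f x) ->
  'D_v (fun y => g (f y)) x =
  \sum_(i < m) ('D_v f x) 0 i * 'D_(delta_mx 0 i) g (f x).
Proof.
move=> df dg; rewrite derive_comp// deriveE// [X in 'd g _ X]row_sum_delta.
by rewrite linear_sum; apply: eq_bigr => i _; rewrite linearZ /= !deriveE.
Qed.

(** A derivative of g o f is a sum of products of derivatives of f with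
    compositions of partial derivatives of g with f, so the induction on k
    passes through sums, products and the composition itself at order k. *)
Lemma ck_comp_real k (f : V -> 'rV[R]_m) (g : 'rV[R]_m -> R) :
  (forall x, A x -> B (f x)) -> ck k A f -> ck k B g ->
  ck k A (fun x => g (f x)).
Proof.
move=> AB; elim: k g => [|k IH] g cf cg; (split=> [x Ax|];
  first by apply: differentiable_comp; [exact: (ck_differentiable cf)|
    exact/(ck_differentiable cg)/AB]).
  by [].
move=> v.
have cs : ck k A (fun x => \sum_(i < m) ('D_v f x) 0 i * 'D_(delta_mx 0 i) g (f x)).
  apply: ck_sum => // i; apply: ckM => //.
    by apply: ck_coord => //; case: cf => _; exact.
  apply: (IH (fun y => 'D_(delta_mx 0 i) g y)); first exact: ckS.
  by case: cg => _; exact.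
apply: (ck_eq oA _ cs) => x Ax; rewrite derive_comp_coord//.
  exact: (ck_differentiable cf).
exact/(ck_differentiable cg)/AB.
Qed.

Lemma smooth_on_comp n (f : V -> 'rV[R]_m) (g : 'rV[R]_m -> 'rV[R]_n) :
  (forall x, A x -> B (f x)) -> smooth_on A f -> smooth_on B g ->
  smooth_on A (fun x => g (f x)).
Proof.
move=> AB /smooth_onP cf /smooth_onP cg; apply/smooth_onP => k.
apply: ck_row => // i; apply: (@ck_comp_real k f (fun y => g y 0 i) AB (cf k)).
exact: ck_coord oB (cg k).
Qed.

End CkComp.

(** * Linear forms depending on a parameter *)

Lemma linear_rowE (R : realType) n (W : lmodType R) (g : 'rV[R]_n -> W) x :
  (forall a x y, g (a *: x + y) = a *: g x + g y) ->
  g x = \sum_(i < n) x 0 i *: g (delta_mx 0 i).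
Proof.
move=> gl.
have g0 : g 0 = 0 by have := gl (-1) 0 0; rewrite scaler0 addr0 scaleN1r addNr.
have gD x1 x2 : g (x1 + x2) = g x1 + g x2.
  by have := gl 1 x1 x2; rewrite !scale1r.
rewrite {1}[x]row_sum_delta (big_morph g gD g0); apply: eq_bigr => i _.
by rewrite -[_ *: _]addr0 gl g0 addr0.
Qed.

Section LinearFamily.
Context {R : realType} {n : nat}.
Implicit Types (F : R -> 'rV[R]_n -> R) (v : R -> 'rV[R]_n).

Definition linear_form (g : 'rV[R]_n -> R) :=
  forall a x y, g (a *: x + y) = a * g x + g y.

Lemma linear_formE g x : linear_form g ->
  g x = \sum_(i < n) x 0 i * g (delta_mx 0 i).
Proof. exact: (@linear_rowE R n R^o). Qed.

(** A product rule.  Expanding in the canonical basis reduces it to the one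
    for real functions, and shows at the same time that dF is linear. *)
Lemma is_derive_linear_form F dF v t dv :
  (\forall s \near t, linear_form (F s)) ->
  (forall x, is_derive t 1 (F ^~ x) (dF x)) -> is_derive t 1 v dv ->
  is_derive t 1 (fun s => F s (v s)) (dF (v t) + F t dv).
Proof.
move=> Fl FdF vdv.
have Flt : linear_form (F t) by exact: nbhs_singleton Fl.
have dFE x : dF x = \sum_(i < n) x 0 i * dF (delta_mx 0 i).
  have h1 : is_derive t 1 (fun s => \sum_(i < n) x 0 i *: F s (delta_mx 0 i))
     (\sum_(i < n) x 0 i *: dF (delta_mx 0 i)).
    have -> : (fun s => \sum_(i < n) x 0 i *: F s (delta_mx 0 i)) =
      \sum_(i < n) (x 0 i \*: F ^~ (delta_mx 0 i)).
      by apply/funext => s; rewrite fct_sumE.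
    exact: is_derive_sum.
  rewrite -[LHS](@derive_val _ _ _ _ _ _ _ (FdF x)) -[RHS](@derive_val _ _ _ _ _ _ _ h1).
  apply: near_eq_derive; near=> s.
  by rewrite {1}(linear_formE x)//; near: s.
have vi i : is_derive t 1 (fun s => v s 0 i) (dv 0 i).
  have [dvt <-] := vdv; apply: DeriveDef.
    by move/derivable_mxP : dvt; apply.
  by rewrite derive_mx// mxE.
have h2 : is_derive t 1 (fun s => \sum_(i < n) v s 0 i * F s (delta_mx 0 i))
     (\sum_(i < n) (v t 0 i *: dF (delta_mx 0 i) + F t (delta_mx 0 i) *: dv 0 i)).
  have -> : (fun s => \sum_(i < n) v s 0 i * F s (delta_mx 0 i)) =
      \sum_(i < n) ((fun s => v s 0 i) * F ^~ (delta_mx 0 i)).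
    by apply/funext => s; rewrite fct_sumE.
  by apply: is_derive_sum => i; apply: is_deriveM.
have -> : dF (v t) + F t dv =
    \sum_(i < n) (v t 0 i *: dF (delta_mx 0 i) + F t (delta_mx 0 i) *: dv 0 i).
  rewrite dFE (linear_formE dv)// -big_split/=; apply: eq_bigr => i _.
  by congr (_ + _); rewrite mulrC.
apply: near_eq_is_derive h2; near=> s.
by rewrite -linear_formE//; near: s.
Unshelve. all: by end_near. Qed.

Lemma continuous_linear_form F v t :
  (\forall s \near t, linear_form (F s)) ->
  (forall x, {for t, continuous (F ^~ x)}) -> {for t, continuous v} ->
  {for t, continuous (fun s => F s (v s))}.
Proof.
move=> Fl cF cv.
have h : {for t, continuous (fun s => \sum_(i < n) v s 0 i * F s (delta_mx 0 i))}.
  have -> : (fun s => \sum_(i < n) v s 0 i * F s (delta_mx 0 i)) =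
      \sum_(i < n) ((fun s => v s 0 i) \* F ^~ (delta_mx 0 i)).
    by apply/funext => s; rewrite fct_sumE.
  elim/big_ind : _ => [|h1 h2|i _]; [exact: cst_continuous|exact: continuousD|].
  apply: cvgM; last exact: cF.
  apply: (@continuous_comp _ _ _ v (fun x : 'rV[R]_n => x 0 i)) => //.
  exact: coord_continuous.
rewrite /prop_for /continuous_at linear_formE; last exact: nbhs_singleton Fl.
apply: cvg_trans h; apply: near_eq_cvg; near=> s.
by rewrite -linear_formE//; near: s.
Unshelve. all: by end_near. Qed.

End LinearFamily.

(** On the kernel of l the form q must vanish: if y is in the kernel, then
    q (y + eps e) l (y + eps e) = eps (l e) (q y + eps (q e)) changes sign at
    eps = 0 unless q y = 0. *)
Lemma proportional_forms (R : realType) n (q l : 'rV[R]_n -> R) e x :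
  linear_form q -> linear_form l -> (forall y, 0 <= q y * l y) ->
  l e != 0 -> q x = q e / l e * l x.
Proof.
move=> ql ll ge0 le0.
pose d := q x - q e / l e * l x.
suff d0 : d = 0 by apply/eqP; rewrite -subr_eq0 -/d d0.
pose t := q e * l e.
pose s := (1 + t ^+ 2)^-1.
have s0 : 0 < s by rewrite invr_gt0 ltr_pwDl// sqr_ge0.
(* k e + x = y + eps e for y := x - (l x / l e) e in the kernel of l and
   eps := - d s (l e), where s is so small that s t < 1. *)
pose k := - (d * s * l e) - l x / l e.
have := ge0 (k *: e + x); rewrite ql ll.
have -> : k * l e + l x = - (d * s * l e ^+ 2).
  by rewrite /k; field.
have -> : k * q e + q x = d * (1 - s * t).
  by rewrite /k /t /d; field.
have -> : d * (1 - s * t) * - (d * s * l e ^+ 2) =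
    - (d ^+ 2 * (s * l e ^+ 2 * (1 - s * t))) by ring.
have st : 0 < 1 - s * t.
  rewrite subr_gt0 /s mulrC ltr_pdivrMr ?mul1r; last by rewrite ltr_pwDl// sqr_ge0.
  by have := sqr_ge0 (t - 2^-1); rewrite sqrrB; lra.
have le2 : 0 < s * l e ^+ 2 by rewrite mulr_gt0// exprn_even_gt0.
rewrite oppr_ge0 (pmulr_lle0 _ (mulr_gt0 le2 st)) => dd.
by apply/eqP; rewrite -sqrf_eq0 eq_le dd sqr_ge0.
Qed.

(** * Uniqueness for linear differential inequalities *)

Section Gronwall.
Context {R : realType}.

Lemma near_dist_lt (c : R) (P : R -> Prop) : (\forall s \near c, P s) ->
  exists2 e : R, 0 < e & forall s, `|s - c| < e -> P s.
Proof.
move=> /nbhs_ballP[e e0 eP]; exists e => // s se; apply: eP.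
by rewrite /ball/= distrC.
Qed.

Lemma dist_lt_near (c e : R) (P : R -> Prop) : 0 < e ->
  (forall s, `|s - c| < e -> P s) -> \forall s \near c, P s.
Proof.
move=> e0 eP; apply/nbhs_ballP; exists e => // s.
by rewrite /ball/= distrC; exact: eP.
Qed.

(** E(t) exp(- K t) is nonincreasing to the right of c, and E(t) exp(K t) is
    nondecreasing to the left of c. *)
Lemma gronwall (E dE : R -> R) (K c : R) :
  (\forall s \near c, [/\ is_derive (s : R) 1 E (dE s), 0 <= E s & `|dE s| <= K * E s]) ->
  E c = 0 -> \forall s \near c, E s = 0.
Proof.
move=> /near_dist_lt[e e0 H] Ec.
apply: (dist_lt_near e0) => t tc.
have [_ Et0 _] := H _ tc.
apply/eqP; rewrite eq_le Et0 andbT.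
have expd (k s : R) : is_derive s 1 (fun s : R => expR (k * s)) (k * expR (k * s)).
  have h : is_derive s 1 (fun s : R => k * s) k.
    by apply: is_derive_eq; rewrite /GRing.scale/= mulr1.
  have := is_derive1_comp (is_derive_expR (k * s)) h.
  by move=> hh; apply: is_derive_eq; rewrite mulrC.
have hd (k s : R) : `|s - c| < e ->
    is_derive s 1 (fun s => E s * expR (k * s)) ((dE s + k * E s) * expR (k * s)).
  move=> /H[dEs _ _]; have := is_deriveM dEs (expd k s) => hh.
  by apply: is_derive_eq; rewrite /GRing.scale/=; ring.
have E0 k s : E s * expR (k * s) <= E c * expR (k * c) -> E s <= 0.
  by rewrite Ec mul0r pmulr_lle0// expR_gt0.
have [tlc|clt|->] := ltgtP t c; last by rewrite Ec.
- apply: (E0 K).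
  have inb s : s \in `[t, c] -> `|s - c| < e.
    rewrite in_itv/= => /andP[ts sc].
    by move: tc; rewrite !ltr_norml => /andP[? ?]; apply/andP; split; lra.
  apply: (@ger0_derive1_le_cc _ (fun s => E s * expR (K * s)) t c) => //; try by [rewrite in_itv/= ?lexx ltW|exact: ltW].
  + move=> s /subset_itv_oo_cc/inb sb.
    by have [] := hd K s sb.
  + move=> s /subset_itv_oo_cc/inb sb.
    rewrite derive1E (@derive_val _ _ _ _ _ _ _ (hd K s sb)) mulr_ge0 ?expR_ge0//.
    have [_ _] := H s sb; rewrite ler_norml => /andP[]; lra.
  + apply: derivable_within_continuous => s /inb sb.
    by have [] := hd K s sb.
- apply: (E0 (- K)).
  have inb s : s \in `[c, t] -> `|s - c| < e.
    rewrite in_itv/= => /andP[ts sc].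
    by move: tc; rewrite !ltr_norml => /andP[? ?]; apply/andP; split; lra.
  apply: (@ler0_derive1_le_cc _ (fun s => E s * expR (- K * s)) c t) => //; try by [rewrite in_itv/= ?lexx ltW|exact: ltW].
  + move=> s /subset_itv_oo_cc/inb sb.
    by have [] := hd (- K) s sb.
  + move=> s /subset_itv_oo_cc/inb sb.
    rewrite derive1E (@derive_val _ _ _ _ _ _ _ (hd (- K) s sb)).
    rewrite mulr_le0_ge0 ?expR_ge0//.
    have [_ _] := H s sb; rewrite ler_norml => /andP[]; lra.
  + apply: derivable_within_continuous => s /inb sb.
    by have [] := hd (- K) s sb.
Qed.

(** The energy E := sum of the u_i^2 satisfies |E'| <= 2 m C E, by
    2 |u_i| |u_j| <= u_i^2 + u_j^2. *)
Lemma gronwall_system m (u du : 'I_m -> R -> R) (C c : R) : 0 <= C ->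
  (\forall s \near c, forall i, is_derive (s : R) 1 (u i) (du i s) /\
     `|du i s| <= C * \sum_(j < m) `|u j s|) ->
  (forall i, u i c = 0) -> \forall s \near c, forall i, u i s = 0.
Proof.
move=> C0 H uc.
pose E s := \sum_(i < m) u i s ^+ 2.
pose dE s := \sum_(i < m) (u i s *: du i s + u i s *: du i s).
have E0 s : 0 <= E s by apply: sumr_ge0 => i _; exact: sqr_ge0.
have : \forall s \near c, E s = 0.
  apply: (@gronwall E dE ((C *+ m) *+ 2)); last first.
    by rewrite /E big1// => i _; rewrite uc expr0n.
  near=> s.
  have Hs : forall i, is_derive (s : R) 1 (u i) (du i s) /\
     `|du i s| <= C * \sum_(j < m) `|u j s| by near: s.
  split=> //.
    have -> : E = \sum_(i < m) (u i * u i).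
      by apply/funext => r; rewrite fct_sumE; apply: eq_bigr => i _; rewrite expr2.
    apply: is_derive_sum => i; apply: is_deriveM; exact: (Hs i).1.
  have -> : C *+ m *+ 2 * E s =
      \sum_(i < m) \sum_(j < m) C * (u i s ^+ 2 + u j s ^+ 2).
    under eq_bigr do (rewrite -mulr_sumr big_split/= sumr_const card_ord -/(E s)).
    rewrite -mulr_sumr big_split/= sumr_const card_ord sumrMnl -/(E s).
    by rewrite -mulr2n !mulrnAr !mulrnAl.
  rewrite (le_trans (ler_norm_sum _ _ _))//; apply: ler_sum => i _.
  rewrite -mulr2n normrMn normrM.
  rewrite -mulr_sumr.
  apply: (@le_trans _ _ ((`|u i s| * (C * \sum_(j < m) `|u j s|)) *+ 2)).
    by rewrite lerMn2r/= ler_wpM2l// (Hs i).2.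
  rewrite mulrCA -mulrnAr ler_wpM2l// mulr_sumr -sumrMnl; apply: ler_sum => j _.
  rewrite -[u i s ^+ 2]real_normK ?num_real// -[u j s ^+ 2]real_normK ?num_real//.
  by have := sqr_ge0 (`|u i s| - `|u j s|); rewrite sqrrB; lra.
apply: filterS => s /eqP; rewrite psumr_eq0; last by move=> i _; exact: sqr_ge0.
by move=> /allP h i; have := h i (mem_index_enum _); rewrite /= sqrf_eq0 => /eqP.
Unshelve. all: by end_near. Qed.

Lemma gronwall_second_order (f g q : R -> R) (C c : R) : 0 <= C ->
  (\forall s \near c, [/\ is_derive (s : R) 1 f (g s), is_derive (s : R) 1 g (q s) &
     `|q s| <= C * `|f s| ]) ->
  f c = 0 -> g c = 0 -> \forall s \near c, f s = 0.
Proof.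
move=> C0 H fc gc.
pose u (i : 'I_2) := if i == 0 then f else g.
pose du (i : 'I_2) := if i == 0 then g else q.
have : \forall s \near c, forall i, u i s = 0.
  apply: (@gronwall_system _ u du (C + 1)); first by rewrite addr_ge0.
  - apply: filterS H => s [df dg qs] i; rewrite big_ord_recl big_ord1.
    rewrite /u /du /=; case: (i == 0); split=> //.
      by have := normr_ge0 (f s); have := normr_ge0 (g s); nra.
    by have := normr_ge0 (f s); have := normr_ge0 (g s); nra.
  - by move=> i; rewrite /u; case: (i == 0).
by apply: filterS => s /(_ 0).
Qed.

End Gronwall.

(** * Functions with nonnegative f f'' *)

Section TwoZeros.
Context {R : realType}.
Variables (I : set R) (f g q : R -> R).
Hypothesis (I_itv : is_interval I).
Hypotheses (df : forall t, I t -> is_derive t 1 f (g t)).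
Hypotheses (dg : forall t, I t -> is_derive t 1 g (q t)).
Hypotheses (fq_ge0 : forall t, I t -> 0 <= f t * q t).
Hypotheses (f_uniq : forall t, I t -> f t = 0 -> g t = 0 ->
  \forall s \near t, f s = 0).

Lemma zero_between_zeros a b t : I a -> I b -> f a = 0 -> f b = 0 ->
  a <= t <= b -> f t = 0.
Proof.
move=> Ia Ib fa fb atb.
have /andP[a_t tb] := atb; have ab := le_trans a_t tb.
have Icc s : s \in `[a, b] -> I s by rewrite in_itv/=; exact: I_itv.
have aab : a \in `[a, b] by rewrite in_itv/= lexx.
have bab : b \in `[a, b] by rewrite in_itv/= lexx andbT.
have d1 (s : R) : I s -> is_derive s 1 (fun s => f s * g s) (g s ^+ 2 + f s * q s).
  move=> Is; have := is_deriveM (df Is) (dg Is) => h.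
  by apply: is_derive_eq; rewrite /GRing.scale/=; ring.
have d2 (s : R) : I s -> is_derive s 1 (fun s => f s * f s) (f s * g s *+ 2).
  move=> Is; have := is_deriveM (df Is) (df Is) => h.
  by apply: is_derive_eq; rewrite /GRing.scale/=; ring.
have mono : {in `[a, b] &, {homo (fun s => f s * g s) : x y / x <= y >-> x <= y}}.
  apply: ger0_derive1_le_cc.
  - by move=> s /subset_itv_oo_cc/Icc/d1[].
  - move=> s /subset_itv_oo_cc/Icc Is.
    rewrite derive1E (@derive_val _ _ _ _ _ _ _ (d1 s Is)).
    by rewrite addr_ge0 ?sqr_ge0 ?fq_ge0.
  - by apply: derivable_within_continuous => s /Icc/d1[].
have fg0 s : s \in `[a, b] -> f s * g s = 0.
  move=> sab; move: (sab); rewrite in_itv/= => /andP[a_s sb]; apply: le_anti.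
  have := mono _ _ aab sab a_s; have := mono _ _ sab bab sb.
  by rewrite fa fb !mul0r => -> ->.
have decr : {in `[a, b] &, {homo (fun s => f s * f s) : x y /~ x <= y}}.
  apply: ler0_derive1_le_cc.
  - by move=> s /subset_itv_oo_cc/Icc/d2[].
  - move=> s /subset_itv_oo_cc sab; have Is := Icc _ sab.
    by rewrite derive1E (@derive_val _ _ _ _ _ _ _ (d2 s Is)) fg0// mul0rn.
  - by apply: derivable_within_continuous => s /Icc/d2[].
have := decr _ _ (_ : t \in `[a, b]) aab a_t.
rewrite in_itv/= atb fa mul0r -expr2 => /(_ isT) ft.
by apply/eqP; rewrite -sqrf_eq0 eq_le ft sqr_ge0.
Qed.

(** The points where f = g = 0 form a closed subset of I, which is open by the
    uniqueness hypothesis and contains the midpoint of two zeros of f. *)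
Lemma zero_of_two_zeros a b : I a -> I b -> a < b -> f a = 0 -> f b = 0 ->
  forall t, I t -> f t = 0.
Proof.
move=> Ia Ib ab fa fb.
have Icon : connected I by apply/connected_intervalP.
pose Z := [set t | I t /\ (f t = 0 /\ g t = 0)].
pose N := [set t | I t /\ \forall s \near t, f s = 0].
have near0 t : I t -> (\forall s \near t, f s = 0) -> f t = 0 /\ g t = 0.
  move=> It ft; split; first exact: nbhs_singleton ft.
  rewrite -(@derive_val _ _ _ _ _ _ _ (df It)).
  by rewrite (near_eq_derive _ (_ : \near t, f t = cst 0 t))// derive_cst.
have fc t : I t -> {for t, continuous f}.
  by move=> /df[/derivable1_diffP/differentiable_continuous].
have gc t : I t -> {for t, continuous g}.
  by move=> /dg[/derivable1_diffP/differentiable_continuous].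
have ZN : Z = N.
  apply/seteqP; split=> t [It].
    by move=> [ft gt]; split=> //; exact: f_uniq.
  by move=> ft; split=> //; exact: near0.
suff ZI : Z = I by move=> t; rewrite -ZI => -[_ []].
apply: Icon.
- pose m := (a + b) / 2.
  have Im : I m by apply: (I_itv Ia Ib); apply/andP; split; rewrite /m; lra.
  rewrite ZN; exists m; split=> //.
  have : \forall s \near m, s \in `]a, b[.
    by apply: near_in_itvoo; rewrite in_itv/=; apply/andP; split; rewrite /m; lra.
  apply: filterS => s /subset_itv_oo_cc; rewrite in_itv/=.
  exact: zero_between_zeros.
- exists (interior [set t | f t = 0]); first exact: open_interior.
  by rewrite ZN; apply/seteqP; split=> t [].
- exists (closure Z); first exact: closed_closure.
  apply/seteqP; split=> t.
    by move=> Zt; split; [by case: Zt|exact: subset_closure].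
  move=> [It Zt]; split=> //.
  have cl0 h : {for t, continuous h} -> (forall s, Z s -> h s = 0 :> R) -> h t = 0.
    move=> ch hZ; apply: contrapT => /eqP ht.
    have /Zt[s [Zs]] : nbhs t [set s | h s != 0].
      exact: (ch _ (open_nbhs_nbhs (conj (@open_neq _ 0) ht))).
    by rewrite /= hZ ?eqxx.
  by split; apply: cl0; [exact: fc|by move=> s [_ []]|exact: gc|by move=> s [_ []]].
Qed.

End TwoZeros.

(** * Constant-coefficient fields in a chart *)

Section Charts.
Context {R : realType} {n : nat} {M : manifold R n}.
Implicit Types (c d e : chart M) (p q : M) (U : set M).

Lemma chart_inv_near c p U : open U -> U p -> dom c p ->
  \forall x \near phi c p,
    [/\ dom c (chart_inv c x), phi c (chart_inv c x) = x & U (chart_inv c x)].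
Proof.
move=> oU Up cp; have imp : (phi c @` dom c) (phi c p) by exists p.
have h1 : \forall x \near phi c p, (phi c @` dom c) x.
  by apply: open_nbhs_nbhs; split=> //; exact: phi_open.
have h2 : \forall x \near phi c p, U (chart_inv c x).
  have := chart_inv_continuous imp; rewrite /prop_for /continuous_at phiK// => h.
  by apply: h; exact: open_nbhs_nbhs.
near=> x.
have Ux : U (chart_inv c x) by near: x.
have [q cq qx] : (phi c @` dom c) x by near: x.
by rewrite -qx phiK// in Ux *.
Unshelve. all: by end_near. Qed.

Lemma chart_image_open c U : open U -> open (phi c @` (U `&` dom c)).
Proof.
move=> oU; rewrite openE => _ [p [Up cp] <-]; rewrite /interior.
apply: filterS (chart_inv_near oU Up cp) => x [cx ex Ux].
by exists (chart_inv c x).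
Qed.

Lemma transition_differentiable c d p : dom c p -> dom d p ->
  differentiable (fun x => phi d (chart_inv c x)) (phi c p).
Proof. by move=> cp dp; apply: (transition_smooth [::]); exists p. Qed.

(** The cocycle identity of the transition maps, differentiated; it makes the
    coordinate vectors of a constant-coefficient field in the various charts
    fit together. *)
Lemma derive_transition c d e p v : dom c p -> dom d p -> dom e p ->
  'D_v (fun x => phi e (chart_inv c x)) (phi c p) =
  'D_('D_v (fun x => phi d (chart_inv c x)) (phi c p))
    (fun x => phi e (chart_inv d x)) (phi d p).
Proof.
move=> cp dp ep.
have e1 : phi d (chart_inv c (phi c p)) = phi d p by rewrite phiK.
rewrite -[X in _ = 'D__ _ X]e1.
rewrite -(@derive_comp _ _ _ _ (fun x => phi d (chart_inv c x))
  (fun x => phi e (chart_inv d x))).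
- apply: near_eq_derive; near=> x.
  have [cx ex dx] : [/\ dom c (chart_inv c x), phi c (chart_inv c x) = x &
     dom d (chart_inv c x)].
    by near: x; apply: chart_inv_near => //; exact: dom_open.
  by rewrite phiK.
- exact: transition_differentiable.
- by rewrite e1; exact: transition_differentiable.
Unshelve. all: by end_near. Qed.

Lemma derive_transition_id c p v : dom c p ->
  'D_v (fun x => phi c (chart_inv c x)) (phi c p) = v.
Proof.
move=> cp; rewrite -[RHS](derive_id (phi c p) v); apply: near_eq_derive.
have := chart_inv_near (dom_open c) cp cp.
by apply: filterS => x [].
Qed.

(** For x = 'e_i this is, definitionally, the coordinate field
    [coord_field c i]. *)
Definition const_field c (x : 'rV[R]_n) (q : M) : tvec M :=
  fun d => if `[< dom d q >]
           then 'D_x (fun y => phi d (chart_inv c y)) (phi c q)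
           else 0.

Lemma const_field_val c x q d : dom d q ->
  const_field c x q d = 'D_x (fun y => phi d (chart_inv c y)) (phi c q).
Proof. by move=> dq; rewrite /const_field asboolT. Qed.

Lemma const_field_chart c x q : dom c q -> const_field c x q c = x.
Proof. by move=> cq; rewrite const_field_val// derive_transition_id. Qed.

Lemma const_field_tangent c x q : dom c q -> tangent q (const_field c x q).
Proof.
move=> cq; split=> [d ndq|d e dq eq]; first by rewrite /const_field asboolF.
by rewrite !const_field_val//; exact: derive_transition.
Qed.

Lemma tangentE c q u : tangent q u -> dom c q -> u = const_field c (u c) q.
Proof.
move=> [u0 ud] cq; apply/funext => d; have [dq|ndq] := pselect (dom d q).
  by rewrite const_field_val// -ud.
by rewrite u0// /const_field asboolF.
Qed.

Lemma const_fieldP c a x y q : dom c q ->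
  const_field c (a *: x + y) q = a *: const_field c x q + const_field c y q.
Proof.
move=> cq; apply/funext => d.
change (const_field c (a *: x + y) q d =
  a *: const_field c x q d + const_field c y q d).
have [dq|ndq] := pselect (dom d q).
  by rewrite !const_field_val// derive_dirP//; exact: transition_differentiable.
by rewrite /const_field asboolF//= scaler0 addr0.
Qed.

Lemma const_field0 c q : dom c q -> const_field c 0 q = 0.
Proof.
move=> cq; have := const_fieldP (-1) 0 0 cq.
by rewrite scaler0 addr0 scaleN1r addNr.
Qed.

Lemma tangentP p a u v : tangent p u -> tangent p v -> tangent p (a *: u + v).
Proof.
move=> pu pv; have cp := mem_chart_at p.
have -> : a *: u + v = const_field (chart_at p) (a *: u (chart_at p) + v (chart_at p)) p.
  by rewrite const_fieldP// -!tangentE.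
exact: const_field_tangent.
Qed.

Lemma tangent0 p : tangent p 0.
Proof.
have cp := mem_chart_at p; rewrite -(const_field0 cp).
exact: const_field_tangent.
Qed.

Lemma tangentD p u v : tangent p u -> tangent p v -> tangent p (u + v).
Proof. by move=> pu pv; rewrite -[u]scale1r; exact: tangentP. Qed.

Lemma tangentN p u : tangent p u -> tangent p (- u).
Proof.
by move=> pu; rewrite -scaleN1r -[_ *: _]addr0; apply/tangentP/tangent0.
Qed.

(** In another chart d the components are the derivative of the transition map
    from c to d, composed with the transition map from d to c. *)
Lemma const_field_smooth c x : smooth_field (dom c) (const_field c x).
Proof.
split=> [p cp|d]; first exact: const_field_tangent.
have oA : open (phi d @` (dom c `&` dom d)) by apply/chart_image_open/dom_open.
have oB : open (phi c @` (dom c `&` dom d)).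
  by rewrite setIC; apply/chart_image_open/dom_open.
have sT : smooth_on (phi d @` (dom c `&` dom d)) (fun y => phi c (chart_inv d y)).
  by rewrite setIC; exact: transition_smooth.
have sD : smooth_on (phi c @` (dom c `&` dom d))
    (fun y => 'D_x (fun y => phi d (chart_inv c y)) y).
  have /smooth_onP h := @transition_smooth _ _ M c d.
  by apply/smooth_onP => k; have [_] := h k.+1; exact.
have AB y : (phi d @` (dom c `&` dom d)) y ->
    (phi c @` (dom c `&` dom d)) (phi c (chart_inv d y)).
  by move=> [p [cp dp] <-]; exists p => //; rewrite phiK.
have /smooth_onP h := smooth_on_comp oA oB AB sT sD.
apply/smooth_onP => k; apply: (ck_eq oA _ (h k)) => _ [p [cp dp] <-].
by rewrite phiK// const_field_val.
Qed.

Lemma smooth_fieldP U a X Y : open U -> smooth_field U X -> smooth_field U Y ->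
  smooth_field U (fun q => a *: X q + Y q).
Proof.
move=> oU [tX sX] [tY sY]; split=> [p Up|c].
  by apply: tangentP; [exact: tX|exact: tY].
have oA : open (phi c @` (U `&` dom c)) by exact: chart_image_open.
have /smooth_onP hX := sX c; have /smooth_onP hY := sY c.
apply/smooth_onP => k; apply: ck_row => // i.
have := ckD oA (ckM oA (ck_cst k _ a) (ck_coord i oA (hX k))) (ck_coord i oA (hY k)).
by apply: ck_eq => // x _; rewrite [RHS]mxE [X in _ = X + _]mxE.
Qed.

Lemma smooth_fun_cst U (a : R) : smooth_fun U (fun=> a).
Proof. by move=> c; apply/smooth_onP => k; exact: ck_cst. Qed.

End Charts.

(** * Curves *)

Section Curve.
Context {R : realType} {n : nat} {M : manifold R n}.
Variables (I : set R) (gamma : R -> M).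
Hypotheses (oI : open I) (gs : smooth_curve I gamma).
Implicit Types (c d : chart M) (t : R) (U : set M).

Lemma near_curve t U : I t -> open U -> U (gamma t) ->
  \forall s \near t, I s /\ U (gamma s).
Proof.
move=> It oU Ut; near=> s; split; near: s.
  exact: open_nbhs_nbhs.
by apply: (gs.1 _ It); exact: open_nbhs_nbhs.
Unshelve. all: by end_near. Qed.

Lemma velocity_val c t : dom c (gamma t) ->
  velocity gamma t c = 'D_1 (fun s => phi c (gamma s)) t.
Proof. by move=> ct; rewrite /velocity asboolT; [exact: derive1E|exact: ct]. Qed.

Lemma curve_is_derive c t : I t -> dom c (gamma t) ->
  is_derive t 1 (fun s => phi c (gamma s)) (velocity gamma t c).
Proof.
move=> It ct; rewrite velocity_val//; apply/derivableP.
by apply/diff_derivable/(gs.2 c [::]).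
Qed.

Lemma velocity_derivable c t : I t -> dom c (gamma t) ->
  derivable (fun s => velocity gamma s c) t 1.
Proof.
move=> It ct; have /diff_derivable h := gs.2 c [:: 1] t (conj It ct).
apply: near_eq_derivable (h 1); near=> s.
have [Is cs] : I s /\ dom c (gamma s).
  by near: s; apply: near_curve => //; exact: dom_open.
by rewrite velocity_val.
Unshelve. all: by end_near. Qed.

Lemma velocity_tangent t : I t -> tangent (gamma t) (velocity gamma t).
Proof.
move=> It; split=> [c nc|c d ct dt]; first by rewrite /velocity asboolF.
have dc := curve_is_derive It ct; have dd := curve_is_derive It dt.
rewrite -(@derive_val _ _ _ _ _ _ _ dd) -(@derive_val _ _ _ _ _ _ _ dc).
rewrite -(@derive_comp _ _ _ _ (fun s => phi c (gamma s))
  (fun x => phi d (chart_inv c x))).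
- apply: near_eq_derive; near=> s.
  have [Is cs] : I s /\ dom c (gamma s).
    by near: s; apply: near_curve => //; exact: dom_open.
  by rewrite phiK.
- by apply/derivable1_diffP; case: dc.
- exact: transition_differentiable.
Unshelve. all: by end_near. Qed.

Lemma is_derive_smooth_fun U h t : open U -> smooth_fun U h -> I t ->
  U (gamma t) ->
  is_derive t 1 (fun s => h (gamma s)) (dirder (gamma t) (velocity gamma t) h).
Proof.
move=> oU sh It Ut; have ct := mem_chart_at (gamma t).
set c := chart_at (gamma t) in ct *.
have dc := curve_is_derive It ct.
have dfc : differentiable (fun s => phi c (gamma s)) t.
  by apply/derivable1_diffP; case: dc.
have dh : differentiable (fun x => h (chart_inv c x)) (phi c (gamma t)).
  by apply: (sh c [::]); exists (gamma t).
have hE : \forall s \near t, h (chart_inv c (phi c (gamma s))) = h (gamma s).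
  near=> s; have [Is cs] : I s /\ dom c (gamma s).
    by near: s; apply: near_curve => //; exact: dom_open.
  by rewrite phiK.
apply: (near_eq_is_derive hE).
rewrite /dirder -/c -(@derive_val _ _ _ _ _ _ _ dc).
rewrite -(@derive_comp _ _ _ _ (fun s => phi c (gamma s))
  (fun x => h (chart_inv c x)))//.
by apply/derivableP/diff_derivable; exact: (differentiable_comp dfc dh).
Unshelve. all: by end_near. Qed.

Lemma derivable_smooth_field U Y c t : open U -> smooth_field U Y -> I t ->
  U (gamma t) -> dom c (gamma t) -> derivable (fun s => Y (gamma s) c) t 1.
Proof.
move=> oU [_ sY] It Ut ct.
have dfc : differentiable (fun s => phi c (gamma s)) t.
  by apply/derivable1_diffP; case: (curve_is_derive It ct).
have dY : differentiable (fun x => Y (chart_inv c x) c) (phi c (gamma t)).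
  by apply: (sY c [::]); exists (gamma t).
have hE : \forall s \near t,
    Y (chart_inv c (phi c (gamma s))) c = Y (gamma s) c.
  near=> s; have [Is cs] : I s /\ dom c (gamma s).
    by near: s; apply: near_curve => //; exact: dom_open.
  by rewrite phiK.
apply: (near_eq_derivable hE); apply: diff_derivable.
exact: (differentiable_comp dfc dY).
Unshelve. all: by end_near. Qed.

End Curve.

(** * Connections on constant-coefficient fields *)

Lemma lincombB (R : realType) (W : lmodType R) (a : R) (x y u u' v v' : W) :
  x = a *: u + u' -> y = a *: v + v' -> x - y = a *: (u - v) + (u' - v').
Proof. by move=> -> ->; rewrite scalerBr opprD addrACA. Qed.

Section Connection.
Context {R : realType} {n : nat} {M : manifold R n}.
Variables (nabla : M -> tvec M -> (M -> tvec M) -> tvec M).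
Hypothesis (hn : affine_connection nabla).
Implicit Types (c d : chart M) (p q : M) (U : set M) (X Y Z : M -> tvec M).

Lemma nabla0 U Y p : open U -> smooth_field U Y -> U p -> nabla p 0 Y = 0.
Proof.
move=> oU sY Up; have := conn_linear hn oU sY (-1) Up (tangent0 p) (tangent0 p).
by rewrite scaler0 addr0 scaleN1r addNr.
Qed.

(** Only the values of Z on U matter, by locality; a constant factor comes out
    by the Leibniz rule, since the derivative of a constant function is 0. *)
Lemma nabla_fieldP U a Y Y' Z p v : open U -> smooth_field U Y ->
  smooth_field U Y' -> smooth_field U Z ->
  (forall q, U q -> Z q = a *: Y q + Y' q) -> U p -> tangent p v ->
  nabla p v Z = a *: nabla p v Y + nabla p v Y'.
Proof.
move=> oU sY sY' sZ ZE Up pv.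
have saY : smooth_field U (fun q => a *: Y q).
  have z0 : smooth_field U (fun q => (0 : tvec M)).
    split=> [q _|c]; first exact: tangent0.
    by apply/smooth_onP => k; exact: (@ck_cst _ _ _ k _ 0).
  have := smooth_fieldP a oU sY z0.
  by congr (smooth_field _ _); apply/funext => q; rewrite addr0.
rewrite (conn_local hn oU sZ (smooth_fieldP a oU sY sY') ZE Up pv).
rewrite (conn_additive hn oU saY sY' Up pv).
rewrite (conn_leibniz hn oU (@smooth_fun_cst _ _ M U a) sY Up pv).
by rewrite /dirder derive_cst scale0r add0r.
Qed.

Lemma nabla_const_fieldP c a x y p v : dom c p -> tangent p v ->
  nabla p v (const_field c (a *: x + y)) =
  a *: nabla p v (const_field c x) + nabla p v (const_field c y).
Proof.
move=> cp pv; apply: (@nabla_fieldP (dom c)) => //; try exact: const_field_smooth.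
  exact: dom_open.
by move=> q cq; exact: const_fieldP.
Qed.

Lemma nabla_tangent U Y p v : open U -> smooth_field U Y -> U p ->
  tangent p v -> tangent p (nabla p v Y).
Proof. by move=> oU sY Up pv; exact: (conn_tangent hn oU sY). Qed.

Lemma nabla_const_smooth c x y :
  smooth_field (dom c) (fun q => nabla q (const_field c x q) (const_field c y)).
Proof.
by apply: (conn_smooth hn (dom_open c)); exact: const_field_smooth.
Qed.

Hypothesis (ht : torsion_free nabla).

(** The component in the chart c is the derivative of constants.  The others
    follow because the bracket is a tangent vector, being a difference of
    covariant derivatives by the vanishing of the torsion. *)
Lemma bracket_const_field c x y p : dom c p ->
  bracket (const_field c x) (const_field c y) p = 0.
Proof.
move=> cp; have oc := dom_open c.
have [sx sy] := (const_field_smooth c x, const_field_smooth c y).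
have tb : tangent p (bracket (const_field c x) (const_field c y) p).
  rewrite -(ht oc sx sy cp); apply: tangentD; last apply: tangentN;
  by apply: (nabla_tangent oc) => //; exact: const_field_tangent.
rewrite (tangentE tb cp) (_ : bracket _ _ p c = 0) ?const_field0//.
rewrite /bracket asboolT//.
have dcst (u v : 'rV[R]_n) :
    'D_v (fun x => const_field c u (chart_inv c x) c) (phi c p) = 0.
  rewrite (near_eq_derive (g := cst u)) ?derive_cst//.
  apply: filterS (chart_inv_near (dom_open c) cp cp) => z [cz _ _].
  by rewrite const_field_chart.
by rewrite !dcst subrr.
Qed.

(** The curvature on constant-coefficient fields: their bracket vanishes, which
    leaves the two second covariant derivatives. *)
Definition chart_curv c (x y z : 'rV[R]_n) (p : M) : tvec M :=
  nabla p (const_field c x p) (fun q => nabla q (const_field c y q) (const_field c z))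
  - nabla p (const_field c y p)
      (fun q => nabla q (const_field c x q) (const_field c z)).

Lemma curv_const_field c x y z p : dom c p ->
  curv nabla (const_field c x) (const_field c y) (const_field c z) p =
  chart_curv c x y z p.
Proof.
move=> cp; rewrite /curv bracket_const_field//.
by rewrite (nabla0 (dom_open c) (const_field_smooth c z))// subr0.
Qed.

Lemma chart_curv_tangent c x y z p : dom c p -> tangent p (chart_curv c x y z p).
Proof.
move=> cp; apply: tangentD; last apply: tangentN;
  apply: (nabla_tangent (dom_open c)) => //;
  by [exact: nabla_const_smooth|exact: const_field_tangent].
Qed.

Lemma nabla2_linear1 c a x x' y z p : dom c p ->
  nabla p (const_field c (a *: x + x') p)
    (fun q => nabla q (const_field c y q) (const_field c z)) =
  a *: nabla p (const_field c x p)
    (fun q => nabla q (const_field c y q) (const_field c z)) +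
  nabla p (const_field c x' p)
    (fun q => nabla q (const_field c y q) (const_field c z)).
Proof.
move=> cp; rewrite const_fieldP//.
by rewrite (conn_linear hn (dom_open c) (nabla_const_smooth c y z))//;
  exact: const_field_tangent.
Qed.

Lemma nabla2_linear2 c a x y y' z p : dom c p ->
  nabla p (const_field c x p)
    (fun q => nabla q (const_field c (a *: y + y') q) (const_field c z)) =
  a *: nabla p (const_field c x p)
    (fun q => nabla q (const_field c y q) (const_field c z)) +
  nabla p (const_field c x p)
    (fun q => nabla q (const_field c y' q) (const_field c z)).
Proof.
move=> cp; apply: (@nabla_fieldP (dom c)) => //; try exact: nabla_const_smooth;
  [exact: dom_open| |exact: const_field_tangent].
move=> q cq; rewrite const_fieldP//.
by rewrite (conn_linear hn (dom_open c) (const_field_smooth c z))//;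
  exact: const_field_tangent.
Qed.

Lemma nabla2_linear3 c a x y z z' p : dom c p ->
  nabla p (const_field c x p)
    (fun q => nabla q (const_field c y q) (const_field c (a *: z + z'))) =
  a *: nabla p (const_field c x p)
    (fun q => nabla q (const_field c y q) (const_field c z)) +
  nabla p (const_field c x p)
    (fun q => nabla q (const_field c y q) (const_field c z')).
Proof.
move=> cp; apply: (@nabla_fieldP (dom c)) => //; try exact: nabla_const_smooth;
  [exact: dom_open| |exact: const_field_tangent].
by move=> q cq; apply: nabla_const_fieldP => //; exact: const_field_tangent.
Qed.

Lemma chart_curv_linear1 c a x x' y z p : dom c p ->
  chart_curv c (a *: x + x') y z p =
  a *: chart_curv c x y z p + chart_curv c x' y z p.
Proof.
move=> cp; exact: (lincombB (nabla2_linear1 a x x' y z cp) (nabla2_linear2 a y x x' z cp)).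
Qed.

Lemma chart_curv_linear2 c a x y y' z p : dom c p ->
  chart_curv c x (a *: y + y') z p =
  a *: chart_curv c x y z p + chart_curv c x y' z p.
Proof.
move=> cp; exact: (lincombB (nabla2_linear2 a x y y' z cp) (nabla2_linear1 a y y' x z cp)).
Qed.

Lemma chart_curv_linear3 c a x y z z' p : dom c p ->
  chart_curv c x y (a *: z + z') p =
  a *: chart_curv c x y z p + chart_curv c x y z' p.
Proof.
move=> cp; exact: (lincombB (nabla2_linear3 a x y z z' cp) (nabla2_linear3 a y x z z' cp)).
Qed.

End Connection.

(** * Symplectic forms *)

Section Form.
Context {R : realType} {n : nat} {M : manifold R n}.
Variables (Omega : M -> tvec M -> tvec M -> R).
Hypothesis (hO : symplectic_form Omega).
Implicit Types (c d : chart M) (p q : M) (U : set M) (X Y Z : M -> tvec M).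

Lemma form_linearr p a u v w : tangent p u -> tangent p v -> tangent p w ->
  Omega p w (a *: u + v) = a * Omega p w u + Omega p w v.
Proof.
move=> pu pv pw.
rewrite (form_skew hO pw (tangentP a pu pv)) (form_linear hO a pu pv pw).
by rewrite (form_skew hO pw pu) (form_skew hO pw pv) mulrN opprD.
Qed.

Lemma form_addl p u v w : tangent p u -> tangent p v -> tangent p w ->
  Omega p (u + v) w = Omega p u w + Omega p v w.
Proof.
move=> pu pv pw; have := form_linear hO 1 pu pv pw.
by rewrite scale1r mul1r.
Qed.

Lemma form_addr p u v w : tangent p u -> tangent p v -> tangent p w ->
  Omega p w (u + v) = Omega p w u + Omega p w v.
Proof.
move=> pu pv pw; have := form_linearr 1 pu pv pw.
by rewrite scale1r mul1r.
Qed.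

Lemma form_zerol p w : tangent p w -> Omega p 0 w = 0.
Proof.
move=> pw; have := form_linear hO (-1) (tangent0 p) (tangent0 p) pw.
by rewrite scaler0 addr0 mulN1r addNr.
Qed.

Lemma form_zeror p w : tangent p w -> Omega p w 0 = 0.
Proof.
by move=> pw; rewrite (form_skew hO pw (tangent0 p)) form_zerol// oppr0.
Qed.

Lemma form_oppl p u w : tangent p u -> tangent p w -> Omega p (- u) w = - Omega p u w.
Proof.
move=> pu pw; rewrite -scaleN1r -[_ *: _]addr0.
by rewrite (form_linear hO _ pu (tangent0 p))// form_zerol// addr0 mulN1r.
Qed.

Lemma form_alternating p u : tangent p u -> Omega p u u = 0.
Proof. by move=> pu; have := form_skew hO pu pu; lra. Qed.

Lemma form_const_linearl c p w : dom c p -> tangent p w ->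
  linear_form (fun x => Omega p (const_field c x p) w).
Proof.
move=> cp pw a x y; rewrite (const_fieldP a x y cp).
exact: (form_linear hO a (const_field_tangent x cp) (const_field_tangent y cp) pw).
Qed.

Lemma form_const_linearr c p w : dom c p -> tangent p w ->
  linear_form (fun x => Omega p w (const_field c x p)).
Proof.
move=> cp pw a x y; rewrite (const_fieldP a x y cp).
exact: (form_linearr a (const_field_tangent x cp) (const_field_tangent y cp) pw).
Qed.

Lemma form_const_smooth c x y : smooth_fun (dom c)
  (fun p => Omega p (const_field c x p) (const_field c y p)).
Proof. by apply: (form_smooth hO (dom_open c)); exact: const_field_smooth. Qed.

End Form.

(** * Covariant derivatives along a curve *)

Section AlongCurve.
Context {R : realType} {n : nat} {M : manifold R n}.
Variables (nabla : M -> tvec M -> (M -> tvec M) -> tvec M).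
Variables (I : set R) (gamma : R -> M).
Hypotheses (hn : affine_connection nabla).
Hypotheses (oI : open I) (gs : smooth_curve I gamma).
Implicit Types (c : chart M) (t : R).

Let v := velocity gamma.

(** The covariant derivative of the field with components a along gamma,
    without expanding a in the coordinate basis. *)
Definition chart_covd c (a : R -> 'rV[R]_n) t : tvec M :=
  const_field c ('D_1 a t) (gamma t) + nabla (gamma t) (v t) (const_field c (a t)).

Lemma chart_covd_tangent c a t : I t -> dom c (gamma t) ->
  tangent (gamma t) (chart_covd c a t).
Proof.
move=> It ct; apply: tangentD; first exact: const_field_tangent.
apply: (nabla_tangent hn (dom_open c)) => //; first exact: const_field_smooth.
exact: (velocity_tangent oI gs).
Qed.

Lemma covariant_derivativeE J DJ c t : covariant_derivative nabla I gamma J DJ ->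
  I t -> dom c (gamma t) -> derivable (fun s => J s c) t 1 ->
  DJ t = chart_covd c (fun s => J s c) t.
Proof.
move=> hD It ct dJ; rewrite (hD t It c ct) big_split; congr (_ + _).
  rewrite (linear_rowE (g := fun x => const_field c x (gamma t))); last first.
    by move=> a x y; exact: const_fieldP.
  apply: eq_bigr => i _; congr (_ *: _).
  by rewrite derive1E derive_mx// mxE.
rewrite (linear_rowE (g := fun x => nabla (gamma t) (v t) (const_field c x)))//.
move=> a x y; apply: (nabla_const_fieldP hn) => //.
exact: (velocity_tangent oI gs).
Qed.

Lemma nabla_velocity_linear c t x k : dom c (gamma t) ->
  linear_form (fun y =>
    nabla (gamma t) (const_field c y (gamma t)) (const_field c x) c 0 k).
Proof.
move=> ct a y z; rewrite (const_fieldP a y z ct).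
rewrite (conn_linear hn (dom_open c) (const_field_smooth c x) a ct
  (const_field_tangent y ct) (const_field_tangent z ct)).
by rewrite [LHS]mxE [X in X + _]mxE.
Qed.

Lemma nabla_argument_linear c t y k : dom c (gamma t) ->
  linear_form (fun x =>
    nabla (gamma t) (const_field c y (gamma t)) (const_field c x) c 0 k).
Proof.
move=> ct a x z.
have e := nabla_const_fieldP hn a x z ct (const_field_tangent y ct).
apply: (etrans (congr1 (fun w : tvec M => w c 0 k) e)).
set N := nabla (gamma t) (const_field c y (gamma t)).
change ((a *: N (const_field c x) c + N (const_field c z) c) 0 k =
  a * N (const_field c x) c 0 k + N (const_field c z) c 0 k).
by rewrite !mxE.
Qed.

Lemma near_dom c t : I t -> dom c (gamma t) ->
  \forall s \near t, I s /\ dom c (gamma s).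
Proof. by move=> It ct; apply: near_curve => //; exact: dom_open. Qed.

Lemma velocityE c t : I t -> dom c (gamma t) ->
  v t = const_field c (v t c) (gamma t).
Proof. by move=> It ct; apply: tangentE => //; exact: (velocity_tangent oI gs It). Qed.

Lemma nabla_const_derivable c t y x k : I t -> dom c (gamma t) ->
  derivable (fun s =>
    nabla (gamma s) (const_field c y (gamma s)) (const_field c x) c 0 k) t 1.
Proof.
move=> It ct.
have := derivable_smooth_field oI gs (dom_open c) (nabla_const_smooth hn c y x) It ct ct.
by move/derivable_mxP; apply.
Qed.

(** The second derivative of Omega(J, gamma') involves that of J, whose
    existence is obtained here from the smoothness of the connection. *)
Lemma chart_covd_derivable c (a : R -> 'rV[R]_n) t : I t -> dom c (gamma t) ->
  derivable a t 1 -> derivable (fun s => 'D_1 a s) t 1 ->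
  derivable (fun s => chart_covd c a s c) t 1.
Proof.
move=> It ct da dda; apply/derivable_mxP => i k; rewrite ord1.
pose F s x y := nabla (gamma s) (const_field c y (gamma s)) (const_field c x) c 0 k.
have dv := derivableP (velocity_derivable oI gs It ct).
have dF x : is_derive t 1 (fun s => F s x (v s c))
    ('D_1 (fun s => F s x (v t c)) t + F t x ('D_1 (fun s => v s c) t)).
  apply: (@is_derive_linear_form _ _ (fun s => F s x)
    (fun y => 'D_1 (fun s => F s x y) t) (fun s => v s c)) => //.
    by apply: filterS (near_dom It ct) => s [_ cs]; exact: nabla_velocity_linear.
  by move=> y; apply/derivableP/nabla_const_derivable.
have dFa : derivable (fun s => F s (a s) (v s c)) t 1.
  have [] // := @is_derive_linear_form _ _ (fun s x => F s x (v s c)) _ a t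
    _ _ dF (derivableP da).
  by apply: filterS (near_dom It ct) => s [_ cs]; exact: nabla_argument_linear.
have dda0 : derivable (fun s => 'D_1 a s 0 k) t 1.
  by move/derivable_mxP : dda; apply.
apply: near_eq_derivable (derivableD dda0 dFa).
apply: filterS (near_dom It ct) => s [Is cs].
change ('D_1 a s 0 k + F s (a s) (v s c) =
  (const_field c ('D_1 a s) (gamma s) c +
   nabla (gamma s) (v s) (const_field c (a s)) c) 0 k).
by rewrite mxE (const_field_chart _ cs) /F -(velocityE Is cs).
Qed.

Variable (Omega : M -> tvec M -> tvec M -> R).
Hypotheses (hO : symplectic_form Omega) (hp : parallel_form Omega nabla).

(** With frozen coefficients a and b this is the parallelism of Omega, and the
    product rule in a and in b supplies the terms with 'D_1 a and 'D_1 b. *)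
Lemma is_derive_form_const c (a b : R -> 'rV[R]_n) t : I t -> dom c (gamma t) ->
  derivable a t 1 -> derivable b t 1 ->
  is_derive t 1 (fun s => Omega (gamma s)
      (const_field c (a s) (gamma s)) (const_field c (b s) (gamma s)))
    (Omega (gamma t) (chart_covd c a t) (const_field c (b t) (gamma t)) +
     Omega (gamma t) (const_field c (a t) (gamma t)) (chart_covd c b t)).
Proof.
move=> It ct da db.
pose X x s := const_field c x (gamma s).
pose N x := nabla (gamma t) (v t) (const_field c x).
have tX x s : dom c (gamma s) -> tangent (gamma s) (X x s).
  by move=> cs; exact: const_field_tangent.
have tN x : tangent (gamma t) (N x).
  apply: (nabla_tangent hn (dom_open c)) => //; first exact: const_field_smooth.
  exact: (velocity_tangent oI gs).
have d0 x y : is_derive t 1 (fun s => Omega (gamma s) (X x s) (X y s))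
    (Omega (gamma t) (N x) (X y t) + Omega (gamma t) (X x t) (N y)).
  have := is_derive_smooth_fun oI gs (dom_open c) (@form_const_smooth _ _ _ _ hO c x y) It ct.
  have := hp (dom_open c) (const_field_smooth c (v t c)) (const_field_smooth c x)
    (const_field_smooth c y) ct.
  by rewrite -(velocityE It ct) => ->.
have d1 x : is_derive t 1 (fun s => Omega (gamma s) (X x s) (X (b s) s))
    ((Omega (gamma t) (N x) (X (b t) t) + Omega (gamma t) (X x t) (N (b t))) +
     Omega (gamma t) (X x t) (X ('D_1 b t) t)).
  have h := @is_derive_linear_form _ _ (fun s y => Omega (gamma s) (X x s) (X y s))
    _ b t ('D_1 b t) _ (d0 x) (derivableP db).
  apply: h; apply: filterS (near_dom It ct) => s [_ cs].
  exact: (form_const_linearr hO cs (tX x s cs)).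
have h := @is_derive_linear_form _ _ (fun s x => Omega (gamma s) (X x s) (X (b s) s))
    _ a t ('D_1 a t) _ d1 (derivableP da).
apply: is_derive_eq (h _) _.
  apply: filterS (near_dom It ct) => s [_ cs].
  exact: (form_const_linearl hO cs (tX (b s) s cs)).
have eA := form_addl hO (tX ('D_1 a t) t ct) (tN (a t)) (tX (b t) t ct).
have eB := form_addr hO (tX ('D_1 b t) t ct) (tN (b t)) (tX (a t) t ct).
have sum4 (p q r s : R) : p + q + r + s = s + p + (r + q) by ring.
by apply: etrans (sum4 _ _ _ _) _; rewrite -eA -eB.
Qed.

Lemma is_derive_form A B DA DB c t :
  (forall s, I s -> tangent (gamma s) (A s)) ->
  (forall s, I s -> tangent (gamma s) (B s)) ->
  covariant_derivative nabla I gamma A DA ->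
  covariant_derivative nabla I gamma B DB ->
  I t -> dom c (gamma t) ->
  derivable (fun s => A s c) t 1 -> derivable (fun s => B s c) t 1 ->
  is_derive t 1 (fun s => Omega (gamma s) (A s) (B s))
    (Omega (gamma t) (DA t) (B t) + Omega (gamma t) (A t) (DB t)).
Proof.
move=> tA tB hA hB It ct dA dB.
have := is_derive_form_const It ct dA dB.
rewrite -(covariant_derivativeE hA It ct dA) -(covariant_derivativeE hB It ct dB).
rewrite -(tangentE (tA t It) ct) -(tangentE (tB t It) ct).
apply: near_eq_is_derive; apply: filterS (near_dom It ct) => s [Is cs].
by rewrite -(tangentE (tA s Is) cs) -(tangentE (tB s Is) cs).
Qed.

End AlongCurve.

(** * Nonpositive symplectic sectional curvature *)

Section CurvatureSign.
Context {R : realType} {n : nat} {M : manifold R n}.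
Variables (Omega : M -> tvec M -> tvec M -> R).
Variables (nabla : M -> tvec M -> (M -> tvec M) -> tvec M).
Hypotheses (hO : symplectic_form Omega).
Implicit Types (c : chart M) (p : M).

Lemma symplectic_span p u w : tangent p u -> tangent p w -> Omega p u w != 0 ->
  let L := [set z | exists a b : R, z = a *: u + b *: w] in
  plane_basis p L u w /\ symplectic_plane Omega p L.
Proof.
move=> pu pw uw L.
have t0 := tangent0 p.
have pbw b : tangent p (b *: w) by rewrite -[_ *: _]addr0; exact: tangentP.
have bw b z : tangent p z -> Omega p (b *: w) z = b * Omega p w z.
  move=> pz; rewrite -[b *: w]addr0 (form_linear hO b pw t0 pz).
  by rewrite (form_zerol hO pz) addr0.
have coefb a b : Omega p (a *: u + b *: w) u = - (b * Omega p u w).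
  rewrite (form_linear hO a pu (pbw b) pu) (bw b u pu).
  by rewrite (form_alternating hO pu) (form_skew hO pw pu) mulr0 add0r mulrN.
have coefa a b : Omega p (a *: u + b *: w) w = a * Omega p u w.
  rewrite (form_linear hO a pu (pbw b) pw) (bw b w pw).
  by rewrite (form_alternating hO pw) mulr0 addr0.
have basis : plane_basis p L u w.
  split=> // a b ab; have := coefa a b; have := coefb a b.
  rewrite ab (form_zerol hO pu) (form_zerol hO pw) => /esym/eqP + /esym/eqP.
  by rewrite oppr_eq0 !mulf_eq0 (negbTE uw) !orbF => /eqP -> /eqP ->.
split=> //; split; first by exists u, w.
move=> _ [a [b ->]] h.
have Lu : L u by exists 1, 0; rewrite scale1r scale0r addr0.
have Lw : L w by exists 0, 1; rewrite scale1r scale0r add0r.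
have /eqP := h u Lu; have /eqP := h w Lw.
rewrite coefa coefb oppr_eq0 !mulf_eq0 (negbTE uw) !orbF => /eqP -> /eqP ->.
by rewrite !scale0r addr0.
Qed.

Hypotheses (hn : affine_connection nabla) (ht : torsion_free nabla).
Hypotheses (hK : nonpositive_sectional_curvature Omega nabla).

(** When the second factor is nonzero, the fields with coefficients v and x
    span a symplectic plane, whose sectional curvature in the direction of v is
    minus the quotient of the two factors. *)
Lemma curvature_form_sign c p x v : dom c p ->
  0 <= Omega p (chart_curv nabla c v x v p) (const_field c v p) *
       Omega p (const_field c x p) (const_field c v p).
Proof.
move=> cp; have [tx tv] := (const_field_tangent x cp, const_field_tangent v cp).
have [->|l0] := eqVneq (Omega p (const_field c x p) (const_field c v p)) 0.
  by rewrite mulr0.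
have l0' : Omega p (const_field c v p) (const_field c x p) != 0.
  by rewrite (form_skew hO tv tx) oppr_eq0.
have [basis spl] := symplectic_span tv tx l0'.
have := hK spl (dom_open c) cp (const_field_smooth c v) (const_field_smooth c x)
  (const_field_smooth c v) basis.
have Lv : [set z | exists a b : R, z = a *: const_field c v p + b *: const_field c x p]
    (const_field c v p).
  by exists 1, 0; rewrite scale1r scale0r addr0.
move=> /(_ Lv); rewrite /sectional_curvature (curv_const_field hn ht)//.
rewrite (form_skew hO tv tx); set q := Omega p _ _; set l := Omega p _ _ in l0 *.
rewrite invrN mulrN oppr_le0 => ql.
have -> : q * l = q / l * l ^+ 2 by field.
by rewrite mulr_ge0// sqr_ge0.
Qed.

End CurvatureSign.

(** * Geodesics and Jacobi fields *)

Lemma near_bounded (R : realType) (h : R -> R) (t : R) : {for t, continuous h} ->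
  \forall s \near t, `|h s| <= `|h t| + 1.
Proof.
move=> ch; have /cvgrPdist_le /(_ 1 ltr01) := ch.
apply: filterS => s hs; rewrite -[h s](subrK (h t)) addrC.
by rewrite (le_trans (ler_normD _ _))// lerD2l distrC.
Qed.

Lemma le_double_sum (R : numDomainType) m n (h : 'I_m -> 'I_n -> R) i k :
  (forall i k, 0 <= h i k) -> h i k <= \sum_(i < m) \sum_(k < n) h i k.
Proof.
move=> h0; rewrite (bigD1 i)//= (bigD1 k)//= -addrA lerDl addr_ge0//.
  by rewrite sumr_ge0.
by rewrite sumr_ge0// => j _; rewrite sumr_ge0.
Qed.

Section Jacobi.
Context {R : realType} {n : nat} {M : manifold R n}.
Variables (Omega : M -> tvec M -> tvec M -> R).
Variables (nabla : M -> tvec M -> (M -> tvec M) -> tvec M).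
Hypotheses (hO : symplectic_form Omega).
Hypotheses (hn : affine_connection nabla) (ht : torsion_free nabla).
Hypotheses (hp : parallel_form Omega nabla).
Hypotheses (hK : nonpositive_sectional_curvature Omega nabla).
Variables (I : set R) (gamma : R -> M).
Hypotheses (oI : open I) (hg : geodesic nabla I gamma).
Implicit Types (c : chart M) (t : R).

Let v := velocity gamma.
Let gs : smooth_curve I gamma. Proof. by case: hg. Qed.

Let vE c s : I s -> dom c (gamma s) -> v s = const_field c (v s c) (gamma s).
Proof. exact: velocityE. Qed.

Lemma velocity_continuous c t : I t -> dom c (gamma t) ->
  {for t, continuous (fun s => v s c)}.
Proof.
move=> It ct; apply: differentiable_continuous; apply/derivable1_diffP.
exact: (velocity_derivable oI gs).
Qed.

(** The geodesic equation is v_k' = - sum_i v_i G_ik with G_ik the k-th component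
    of the covariant derivative along v of the i-th coordinate field: a linear
    system for v once the continuous functions G_ik are regarded as given. *)
Lemma velocity_zero_near t : I t -> v t = 0 -> \forall s \near t, v s = 0.
Proof.
move=> It vt; have ct := mem_chart_at (gamma t).
set c := chart_at (gamma t) in ct *.
pose G i k s := nabla (gamma s) (v s) (const_field c (delta_mx 0 i)) c 0 k.
have cG i k : {for t, continuous (G i k)}.
  have cv := velocity_continuous It ct.
  pose F s y := nabla (gamma s) (const_field c y (gamma s))
    (const_field c (delta_mx 0 i)) c 0 k.
  have cF : {for t, continuous (fun s => F s (v s c))}.
    apply: continuous_linear_form => //.
      apply: filterS (near_dom oI gs It ct) => s [_ cs].
      exact: (nabla_velocity_linear hn).
    move=> y; apply: differentiable_continuous; apply/derivable1_diffP.
    exact: (nabla_const_derivable hn oI gs).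
  rewrite /prop_for /continuous_at.
  have -> : G i k t = F t (v t c) by rewrite /G /F -(vE It ct).
  apply: cvg_trans cF; apply: near_eq_cvg.
  apply: filterS (near_dom oI gs It ct) => s [Is cs].
  by rewrite /G /F -(vE Is cs).
pose C := \sum_(i < n) \sum_(k < n) (`|G i k t| + 1).
have C_ge i k : `|G i k t| + 1 <= C.
  by apply: (le_double_sum (h := fun i k => `|G i k t| + 1)) => *; exact: addr_ge0.
have C0 : 0 <= C.
  by rewrite sumr_ge0// => j _; rewrite sumr_ge0// => j' _; rewrite addr_ge0.
have GC : \forall s \near t, forall i k, `|G i k s| <= C.
  apply: (@filter_forall _ _ (fun i s => forall k, `|G i k s| <= C) _ (nbhs_filter t)) => i.
  apply: (@filter_forall _ _ (fun k s => `|G i k s| <= C) _ (nbhs_filter t)) => k.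
  by apply: filterS (near_bounded (cG i k)) => s h; exact: le_trans h (C_ge i k).
have : \forall s \near t, forall k, v s c 0 k = 0.
  apply: (@gronwall_system _ _ (fun k s => v s c 0 k)
    (fun k s => 'D_1 (fun s => v s c) s 0 k) C) => //; last first.
    by move=> k; rewrite vt mxE.
  near=> s => k.
  have [Is cs] : I s /\ dom c (gamma s) by near: s; exact: near_dom.
  have Gs : forall i k, `|G i k s| <= C by near: s.
  have dv := velocity_derivable oI gs Is cs.
  split.
    have dvk : derivable (fun s => v s c 0 k) s 1 by move/derivable_mxP : dv; apply.
    by rewrite derive_mx// mxE; exact: derivableP.
  have e0 : 0 = chart_covd nabla gamma c (fun s => v s c) s.
    by apply: (covariant_derivativeE hn oI gs (J := v) (DJ := fun=> 0)) => //; case: hg.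
  have e1 : ('D_1 (fun s => v s c) s +
      nabla (gamma s) (v s) (const_field c (v s c)) c) 0 k = 0.
    transitivity (chart_covd nabla gamma c (fun s => v s c) s c 0 k).
      by rewrite -{1}(const_field_chart ('D_1 (fun s => v s c) s) cs).
    by rewrite -e0; change ((0 : 'rV[R]_n) 0 k = 0); rewrite mxE.
  have -> : 'D_1 (fun s => v s c) s 0 k = - \sum_(i < n) v s c 0 i * G i k s.
    move: e1; rewrite mxE => /eqP; rewrite addr_eq0 => /eqP ->; congr (- _).
    have lin : linear_form (fun x => nabla (gamma s) (v s) (const_field c x) c 0 k).
      rewrite (vE Is cs); exact: (nabla_argument_linear hn).
    exact: (linear_formE (v s c) lin).
  rewrite normrN (le_trans (ler_norm_sum _ _ _))// mulr_sumr.
  by apply: ler_sum => i _; rewrite normrM mulrC ler_wpM2r.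
apply: filterS2 (near_dom oI gs It ct) => s [Is cs] vs0.
rewrite (vE Is cs) (_ : v s c = 0) ?(const_field0 cs)//.
by apply/rowP => k; rewrite vs0 mxE.
Unshelve. all: by end_near. Qed.

Lemma chart_curv_form_continuous c x y z w t : I t -> dom c (gamma t) ->
  {for t, continuous (fun s => Omega (gamma s) (chart_curv nabla c x y z (gamma s))
    (const_field c w (gamma s)))}.
Proof.
move=> It ct.
pose N x y z p := nabla p (const_field c x p)
  (fun p' => nabla p' (const_field c y p') (const_field c z)).
have sN x' y' z' : smooth_field (dom c) (N x' y' z').
  apply: (conn_smooth hn (dom_open c)); first exact: const_field_smooth.
  exact: (nabla_const_smooth hn).
pose h x y z p := Omega p (N x y z p) (const_field c w p).
have ch x' y' z' : {for t, continuous (fun s => h x' y' z' (gamma s))}.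
  have sh : smooth_fun (dom c) (h x' y' z').
    by apply: (form_smooth hO (dom_open c)) => //; exact: const_field_smooth.
  apply: differentiable_continuous; apply/derivable1_diffP.
  by have [] := is_derive_smooth_fun oI gs (dom_open c) sh It ct.
have hE s : dom c (gamma s) ->
    h x y z (gamma s) - h y x z (gamma s) = Omega (gamma s)
      (chart_curv nabla c x y z (gamma s)) (const_field c w (gamma s)).
  move=> cs; have tw := const_field_tangent w cs.
  have tN x' y' z' : tangent (gamma s) (N x' y' z' (gamma s)) by exact: (sN _ _ _).1.
  rewrite /h -(form_oppl hO (tN y x z) tw).
  exact/esym/(form_addl hO (tN x y z) (tangentN (tN y x z)) tw).
have cB := continuousB (ch x y z) (ch y x z).
rewrite /prop_for /continuous_at -hE//; apply: cvg_trans cB; apply: near_eq_cvg.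
by apply: filterS (near_dom oI gs It ct) => s [_ cs]; rewrite -hE.
Qed.

(** For fixed coefficients the expression is a smooth function of the base
    point; each of the three occurrences of the velocity is then a linear slot
    to be filled by a continuous function. *)
Lemma velocity_curv_form_continuous c e t : I t -> dom c (gamma t) ->
  {for t, continuous (fun s => Omega (gamma s)
    (chart_curv nabla c (v s c) e (v s c) (gamma s))
    (const_field c (v s c) (gamma s)))}.
Proof.
move=> It ct; have cv := velocity_continuous It ct.
have nd := near_dom oI gs It ct.
have tX s x : dom c (gamma s) -> tangent (gamma s) (const_field c x (gamma s)).
  by move=> cs; exact: const_field_tangent.
have tK x y z s : dom c (gamma s) ->
    tangent (gamma s) (chart_curv nabla c x y z (gamma s)).
  by move=> cs; exact: (chart_curv_tangent hn).
pose F x z s w := Omega (gamma s) (chart_curv nabla c x e z (gamma s))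
  (const_field c w (gamma s)).
have c1 x z : {for t, continuous (fun s => F x z s (v s c))}.
  have lin : \forall s \near t, linear_form (F x z s).
    by apply: filterS nd => s [_ cs]; exact: (form_const_linearr hO cs (tK _ _ _ _ cs)).
  exact: (@continuous_linear_form _ _ (F x z) (fun s => v s c) t lin (fun w => @chart_curv_form_continuous c x e z w t It ct) cv).
have c2 x : {for t, continuous (fun s => F x (v s c) s (v s c))}.
  have lin : \forall s \near t, linear_form (fun z => F x z s (v s c)).
    apply: filterS nd => s [_ cs] a z z'; rewrite /F (chart_curv_linear3 hn a x e z z' cs).
    exact: (form_linear hO a (tK _ _ _ _ cs) (tK _ _ _ _ cs) (tX _ _ cs)).
  exact: (@continuous_linear_form _ _ (fun s z => F x z s (v s c)) (fun s => v s c)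
    t lin (c1 x) cv).
have lin : \forall s \near t, linear_form (fun x => F x (v s c) s (v s c)).
  apply: filterS nd => s [_ cs] a x x'; rewrite /F (chart_curv_linear1 hn a x x' e _ cs).
  exact: (form_linear hO a (tK _ _ _ _ cs) (tK _ _ _ _ cs) (tX _ _ cs)).
exact: (@continuous_linear_form _ _ (fun s x => F x (v s c) s (v s c))
  (fun s => v s c) t lin c2 cv).
Qed.

Variables (J DJ DDJ : R -> tvec M).
Hypotheses (hJ : field_along I gamma J).
Hypotheses (hDJ : covariant_derivative nabla I gamma J DJ).
Hypotheses (hDDJ : covariant_derivative nabla I gamma DJ DDJ).
Hypotheses (hjac : forall t, I t -> curvature_at nabla (gamma t)
  (velocity gamma t) (J t) (velocity gamma t) (DDJ t)).

Let f t := Omega (gamma t) (J t) (v t).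
Let g t := Omega (gamma t) (DJ t) (v t).
Let q t := Omega (gamma t) (DDJ t) (v t).

Lemma field_derivable c t : I t -> dom c (gamma t) ->
  derivable (fun s => J s c) t 1.
Proof. by move=> It ct; apply: diff_derivable; exact: (hJ.2 c [::]). Qed.

Lemma field_derivable2 c t : I t -> dom c (gamma t) ->
  derivable (fun s => 'D_1 (fun s => J s c) s) t 1.
Proof. by move=> It ct; apply: diff_derivable; exact: (hJ.2 c [:: 1]). Qed.

Lemma DJ_tangent t : I t -> tangent (gamma t) (DJ t).
Proof.
move=> It; have ct := mem_chart_at (gamma t).
rewrite (covariant_derivativeE hn oI gs hDJ It ct (field_derivable It ct)).
exact: (chart_covd_tangent hn oI gs).
Qed.

Lemma DJ_derivable c t : I t -> dom c (gamma t) ->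
  derivable (fun s => DJ s c) t 1.
Proof.
move=> It ct.
have := chart_covd_derivable hn oI gs It ct (field_derivable It ct)
  (field_derivable2 It ct).
apply: near_eq_derivable; apply: filterS (near_dom oI gs It ct) => s [Is cs].
by rewrite (covariant_derivativeE hn oI gs hDJ Is cs (field_derivable Is cs)).
Qed.

Lemma is_derive_pairing t : I t -> is_derive t 1 f (g t).
Proof.
move=> It; have ct := mem_chart_at (gamma t).
have tv s : I s -> tangent (gamma s) (v s) by exact: (velocity_tangent oI gs).
have := is_derive_form hn oI gs hO hp hJ.1 tv hDJ hg.2 It ct
  (field_derivable It ct) (velocity_derivable oI gs It ct).
by rewrite (form_zeror hO (hJ.1 t It)) addr0.
Qed.

Lemma is_derive_pairing' t : I t -> is_derive t 1 g (q t).
Proof.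
move=> It; have ct := mem_chart_at (gamma t).
have tv s : I s -> tangent (gamma s) (v s) by exact: (velocity_tangent oI gs).
have := is_derive_form hn oI gs hO hp DJ_tangent tv hDDJ hg.2 It ct
  (DJ_derivable It ct) (velocity_derivable oI gs It ct).
by rewrite (form_zeror hO (DJ_tangent It)) addr0.
Qed.

Lemma pairing''E c t : I t -> dom c (gamma t) ->
  q t = Omega (gamma t) (chart_curv nabla c (v t c) (J t c) (v t c) (gamma t))
    (const_field c (v t c) (gamma t)).
Proof.
move=> It ct; have vt := vE It ct.
rewrite /q -vt; congr (Omega _ _ _).
rewrite -(curv_const_field hn ht (v t c) (J t c) (v t c) ct); apply/esym.
apply: (hjac It (dom_open c) ct); try exact: const_field_smooth.
- exact: (esym vt).
- by rewrite -(tangentE (hJ.1 t It) ct).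
- exact: (esym vt).
Qed.

Lemma pairingE c t : I t -> dom c (gamma t) ->
  f t = Omega (gamma t) (const_field c (J t c) (gamma t))
    (const_field c (v t c) (gamma t)).
Proof.
move=> It ct; rewrite -(tangentE (hJ.1 t It) ct).
by have vt := vE It ct; rewrite /f -vt.
Qed.

Lemma pairing_mul_pairing''_ge0 t : I t -> 0 <= f t * q t.
Proof.
move=> It; have ct := mem_chart_at (gamma t).
by rewrite (pairingE It ct) (pairing''E It ct) mulrC (curvature_form_sign hO hn ht hK).
Qed.

(** Local uniqueness for f'' = kappa f.  The factor kappa = K e / l e is
    evaluated on a field e with constant coefficients, which makes its
    continuity visible even where l vanishes on J. *)
Lemma pairing_zero_near t : I t -> f t = 0 -> g t = 0 -> \forall s \near t, f s = 0.
Proof.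
move=> It ft gt; have ct := mem_chart_at (gamma t).
set c := chart_at (gamma t) in ct *.
have [vt0|vt0] := pselect (v t = 0).
  apply: filterS2 (near_dom oI gs It ct) (velocity_zero_near It vt0) => s [Is _] vs.
  by rewrite /f vs (form_zeror hO (hJ.1 s Is)).
have tvt := velocity_tangent oI gs It.
have [w [tw vw]] : exists w, tangent (gamma t) w /\ Omega (gamma t) (v t) w != 0.
  apply: contrapT => h; apply: vt0; apply: (form_nondegenerate hO tvt) => w tw.
  by apply/eqP; apply: contrapT => /negP vw; apply: h; exists w.
pose e := w c.
pose V s x := const_field c x (gamma s).
pose l s x := Omega (gamma s) (V s x) (V s (v s c)).
pose K s x := Omega (gamma s)
  (chart_curv nabla c (v s c) x (v s c) (gamma s)) (V s (v s c)).
have tV s x : dom c (gamma s) -> tangent (gamma s) (V s x).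
  by move=> cs; exact: const_field_tangent.
have cv := velocity_continuous It ct.
have nd := near_dom oI gs It ct.
have cfun h : smooth_fun (dom c) h -> {for t, continuous (fun s => h (gamma s))}.
  move=> sh; apply: differentiable_continuous; apply/derivable1_diffP.
  by have [] := is_derive_smooth_fun oI gs (dom_open c) sh It ct.
have cl : {for t, continuous (fun s => l s e)}.
  apply: (@continuous_linear_form _ _ (fun s y => Omega (gamma s) (V s e) (V s y))) => //.
    apply: filterS nd => s [_ cs].
    exact: (form_const_linearr hO cs (tV s e cs)).
  by move=> x; exact: (cfun _ (@form_const_smooth _ _ _ _ hO c e x)).
have cK : {for t, continuous (fun s => K s e)}.
  exact: velocity_curv_form_continuous.
have curvt x y z s : dom c (gamma s) ->
    tangent (gamma s) (chart_curv nabla c x y z (gamma s)).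
  by move=> cs; exact: (chart_curv_tangent hn).
have le0 : l t e != 0.
  rewrite /l /V -(tangentE tw ct) -(vE It ct).
  by rewrite (form_skew hO tw tvt) oppr_eq0.
have cKl : {for t, continuous (fun s => K s e / l s e)}.
  by apply: cvgM; [exact: cK|exact: (continuousV (s := fun s => l s e))].
have lne : \forall s \near t, l s e != 0.
  exact: (cl _ (open_nbhs_nbhs (conj (@open_neq _ 0) le0))).
apply: (@gronwall_second_order _ f g q (`|K t e / l t e| + 1)) => //.
near=> s.
have [Is cs] : I s /\ dom c (gamma s) by near: s.
split; [exact: is_derive_pairing|exact: is_derive_pairing'|].
rewrite (pairingE Is cs) (pairing''E Is cs).
rewrite -[X in `|X| <= _]/(K s (J s c)) -[X in _ <= _ * `|X|]/(l s (J s c)).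
have linl : linear_form (l s) by exact: (form_const_linearl hO cs (tV _ _ cs)).
have linK : linear_form (K s).
  move=> a x y; rewrite /K (chart_curv_linear2 hn _ _ _ _ _ cs).
  exact: (form_linear hO a (curvt _ _ _ _ cs) (curvt _ _ _ _ cs) (tV _ _ cs)).
rewrite (@proportional_forms _ _ (K s) (l s) e _ linK linl).
- by rewrite normrM ler_wpM2r//; near: s; exact: near_bounded cKl.
- by move=> y; exact: (curvature_form_sign hO hn ht hK).
- by near: s.
Unshelve. all: by end_near. Qed.

End Jacobi.

Theorem lemma7p1 (R : realType) (n : nat) (M : manifold R n)
    (Omega : M -> tvec M -> tvec M -> R)
    (nabla : M -> tvec M -> (M -> tvec M) -> tvec M)
    (I : set R) (gamma : R -> M)
    (hOmega : symplectic_form Omega)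
    (hnabla : symplectic_connection Omega nabla)
    (hcurv : nonpositive_sectional_curvature Omega nabla)
    (hI : open_interval I)
    (hgamma : maximal_geodesic nabla I gamma) :
  (forall J : R -> tvec M, jacobi_field nabla I gamma J ->
     let f := fun t => Omega (gamma t) (J t) (velocity gamma t) in
     [/\ at_most_one_zero I f \/ (forall t, I t -> f t = 0),
         ~ (at_most_one_zero I f /\ (forall t, I t -> f t = 0)) &
         at_most_one_zero I f -> at_most_one_zero I J]) /\
  (forall p q : M, conjugate_points nabla I gamma p q ->
     forall J : R -> tvec M, jacobi_field nabla I gamma J ->
     forall a b : R, I a -> I b -> a <> b -> gamma a = p -> gamma b = q ->
       J a = 0 -> J b = 0 -> coisotropic Omega I gamma J).
Proof.
have [hn ht hp] := hnabla; have [oI iI [t0 It0]] := hI; have [hg _] := hgamma.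
have tv t : I t -> tangent (gamma t) (velocity gamma t).
  by move=> It; exact: (velocity_tangent oI hg.1 It).
have J0 J t : I t -> J t = 0 -> Omega (gamma t) (J t) (velocity gamma t) = 0.
  by move=> It ->; exact: (form_zerol hOmega (tv t It)).
have key J : jacobi_field nabla I gamma J -> forall a b, I a -> I b -> a <> b ->
    Omega (gamma a) (J a) (velocity gamma a) = 0 ->
    Omega (gamma b) (J b) (velocity gamma b) = 0 ->
    coisotropic Omega I gamma J.
  move=> [hJ [DJ [DDJ [hDJ hDDJ hjac]]]].
  suff lt a b : I a -> I b -> a < b ->
      Omega (gamma a) (J a) (velocity gamma a) = 0 ->
      Omega (gamma b) (J b) (velocity gamma b) = 0 ->
      coisotropic Omega I gamma J.
    move=> a b Ia Ib /eqP; rewrite neq_lt => /orP[ab|ba] fa fb.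
      exact: (lt a b).
    exact: (lt b a).
  move=> Ia Ib ab fa fb s Is.
  apply: (@zero_of_two_zeros _ I
    (fun t => Omega (gamma t) (J t) (velocity gamma t))
    (fun t => Omega (gamma t) (DJ t) (velocity gamma t))
    (fun t => Omega (gamma t) (DDJ t) (velocity gamma t)) iI
    _ _ _ _ a b Ia Ib ab fa fb s Is) => t It.
  - exact: (is_derive_pairing hOmega hn hp oI hg hJ hDJ It).
  - exact: (is_derive_pairing' hOmega hn hp oI hg hJ hDJ hDDJ It).
  - exact: (pairing_mul_pairing''_ge0 hOmega hn ht hcurv oI hg hJ hjac It).
  - exact: (pairing_zero_near hOmega hn ht hp hcurv oI hg hJ hDJ hDDJ hjac It).
split=> [J hJ f|p q _ J hJ a b Ia Ib ab _ _ Ja Jb]; last first.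
  by apply: (key J hJ a b Ia Ib ab); exact: J0.
split.
- have [h|h] := pselect (at_most_one_zero I f); [by left|right].
  apply: contrapT => nf; apply: h => a b Ia Ib fa fb.
  by apply: contrapT => ab; apply: nf; exact: (key J hJ a b Ia Ib ab fa fb).
- move=> [h1 h0].
  have /near_dist_lt[e e0 he] : \forall s \near t0, I s by exact: open_nbhs_nbhs.
  have Ie : I (t0 + e / 2).
    by apply: he; rewrite addrC addKr gtr0_norm; lra.
  have := h1 t0 (t0 + e / 2) It0 Ie (h0 _ It0) (h0 _ Ie); lra.
- move=> h s t Is It Js Jt; apply: h => //; exact: J0.
Qed.
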